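(* In the setting of the context, every $u$-based $s$,$d$-flow $g\in L_+(H)^E$ has a $u$-based flow decomposition.
   Context: $G=(V,E)$ finite directed graph with source $s$ and destination $d$, every node connected to $s$; $\delta^\pm(v)$ edges leaving/entering $v$. $H=[0,t_f]$ with Borel $\sigma$-algebra $\mathcal B(H)$ and Lebesgue measure $\sigma$; $L(H)$ integrable real functions up to a.e. equality, $L_+(H)$ nonnegative ones. A walk is $w=(e_1,\dots,e_k)$, $e_j=(v_j,v_{j+1})\in E$, $w[j]=e_j$, $|w|=k$; a cycle is a walk whose first edge leaves and last edge enters the same node; simple if each node has at most one edge of the walk leaving it. $\hat{\mathcal W}$ is the set of $s$,$d$-walks and $\mathcal C$ the set of simple cycles. Fix $u\in L(H)^E$ with induced nonnegative absolutely continuous traversal times $D_e(u,\cdot)$ such that $T_e(u,t):=t+D_e(u,t)$ is nondecreasing; $A_{w,1}(u,\cdot)=\mathrm{id}$, $A_{w,j}(u,\cdot)=T_{w[j-1]}(u,\cdot)\circ\dots\circ T_{w[1]}(u,\cdot)$. Standing assumption: $u$ vanishes a.e. on $[t_f',t_f]$ for some $t_f'<t_f$ and all $A_{w,j}(u,\cdot)$ map $H$ into $H$. $\ell^u_{w,e}(h)$ denotes (if it exists) the function in $L(H)$ with $\int_0^t\ell^u_{w,e}(h)\,d\sigma=\sum_{j\le|w|:w[j]=e}\int_{A_{w,j}(u,\cdot)^{-1}([0,t])}h\,d\sigma$ for all $t$; $\ell^u_w(h)=(\ell^u_{w,e}(h))_{e\in E}$. Node balance $\nabla^u_v g(\mathfrak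 T):=\sum_{e\in\delta^+(v)}\int_{\mathfrak T}g_e\,d\sigma-\sum_{e\in\delta^-(v)}\int_{T_e(u,\cdot)^{-1}(\mathfrak T)}g_e\,d\sigma$; net outflow rate $r_v$ at $v$: $\nabla^u_v g=r_v\cdot\sigma$; flow conservation: $r_v=0$. A $u$-based $s$,$d$-flow is $g\in L_+(H)^E$ with net outflow rate $r_s\in L_+(H)$ at $s$, flow conservation at all $v\notin\{s,d\}$, and $\nabla^u_d g(\mathfrak T)\le0$ for all $\mathfrak T\in\mathcal B(H)$. An inflow rate $h_c\in L_+(H)$ into a cycle $c$ is a zero-cycle inflow rate if for a.a. $t$, $h_c(t)>0$ implies $D_e(u,t)=0$ for all edges $e$ of $c$. A $u$-based flow decomposition of $g$ is a family of walk inflow rates $h_w\in L_+(H)$, $w\in\hat{\mathcal W}$, together with zero-cycle inflow rates $h_c\in L_+(H)$, $c\in\mathcal C$, such that all $\ell^u_w(h_w)$, $\ell^u_c(h_c)$ exist and $g=\sum_{w\in\hat{\mathcal W}}\ell^u_w(h_w)+\sum_{c\in\mathcal C}\ell^u_c(h_c)$ (the series converging in $L(H)^E$). *)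

(* Defs.v *)
From HB Require Import structures.
From mathcomp Require Import all_boot all_order all_algebra finmap.
From mathcomp Require Import all_classical all_reals all_analysis.
From mathcomp Require Import summability.

Set Implicit Arguments.
Unset Strict Implicit.
Unset Printing Implicit Defensive.
Import Order.TTheory GRing.Theory Num.Theory.
Import numFieldNormedType.Exports.

Local Open Scope classical_set_scope.
Local Open Scope ring_scope.

(* The graph is given by finite types V and E and the end nodes
   src e, dst e of every edge e; this allows loops and parallel edges. *)
Section Walks.
Context {V E : finType} (src dst : E -> V).

Definition edge_rel : rel V :=
  [rel v v' | [exists e, (src e == v) && (dst e == v')]].

Definition walk (v v' : V) (w : seq E) : bool :=
  if w is e :: w' then
    [&& src e == v, path [rel e1 e2 | dst e1 == src e2] e w'
      & dst (last e w') == v']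
  else false.

Definition is_walk (w : seq E) : bool := [exists v, exists v', walk v v' w].

(* Edges are counted with multiplicity: the walk that runs twice around a
   cycle is not simple. *)
Definition simple_cycle (c : seq E) : bool :=
  [exists v, walk v v c] && uniq [seq src e | e <- c].

Lemma finite_simple_cycle : finite_set [set c | simple_cycle c].
Proof.
apply: (@sub_finite_set _ _
  ((fun b : #|E|.-bseq E => bseqval b) @` [set: #|E|.-bseq E])).
  move=> c /= /andP[_ /map_uniq /card_uniqP uc].
  have sc : (size c <= #|E|)%N by rewrite -uc max_card.
  by exists (Bseq sc).
by apply: finite_image; exact: finite_finset.
Qed.

End Walks.

(* Elements of L(H) are represented by functions R -> R of which only the
   restriction to H = [0, tf] matters, up to almost everywhere equality. *)
Section Functions.
Context {R : realType}.
Local Notation sigma := (@lebesgue_measure R).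

Definition horizon (tf : R) : set R := `[0, tf].

Definition inL (tf : R) (f : R -> R) : Prop :=
  sigma.-integrable (horizon tf) (EFin \o f).

Definition inLplus (tf : R) (f : R -> R) : Prop :=
  inL tf f /\ {ae sigma, forall t, horizon tf t -> 0 <= f t}.

Definition nondecreasing_on (A : set R) (f : R -> R) : Prop :=
  forall t t', A t -> A t' -> t <= t' -> f t <= f t'.

Definition absolutely_continuous_on (a b : R) (f : R -> R) : Prop :=
  forall eps : R, 0 < eps -> exists2 delta : R, 0 < delta &
    forall (n : nat) (x y : 'I_n -> R),
      (forall i, a <= x i /\ x i <= y i /\ y i <= b) ->
      (forall i j, i != j -> y i <= x j \/ y j <= x i) ->
      \sum_(i < n) (y i - x i) < delta ->
      \sum_(i < n) `|f (y i) - f (x i)| < eps.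

End Functions.

(* D e u is the traversal time D_e(u, .) of the edge e under u. *)
Section Flows.
Context {R : realType} {V E : finType} (src dst : E -> V) (s d : V) (tf : R).
Context (D : E -> (E -> R -> R) -> R -> R) (u : E -> R -> R).
Local Notation sigma := (@lebesgue_measure R).
Local Notation H := (horizon tf).

Definition exit_time (e : E) (t : R) : R := t + D e u t.

(* Positions in a walk are counted from 0: arrival w j is the composition of
   the exit times of the first j edges of w, that is A_{w,j+1}(u, .). *)
Definition arrival (w : seq E) (j : nat) (t : R) : R :=
  foldl (fun t' e => exit_time e t') t (take j w).

(* l is (a representative of) l^u_{w,e}(h) *)
Definition induced_edge_flow (w : seq E) (h : R -> R) (e : E) (l : R -> R) :
    Prop :=
  inL tf l /\
  forall t, H t ->
    \int[sigma]_(x in `[0, t]) l x =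
    \sum_(j < size w | nth e w j == e)
      \int[sigma]_(x in H `&` arrival w j @^-1` `[0, t]) h x.

Definition induced_flow (w : seq E) (h : R -> R) (l : E -> R -> R) : Prop :=
  forall e, induced_edge_flow w h e (l e).

Definition node_balance (v : V) (g : E -> R -> R) (A : set R) : R :=
  \sum_(e | src e == v) \int[sigma]_(t in A) g e t -
  \sum_(e | dst e == v) \int[sigma]_(t in H `&` exit_time e @^-1` A)
    g e t.

Definition net_outflow_rate (v : V) (g : E -> R -> R) (r : R -> R) : Prop :=
  inL tf r /\
  forall A, measurable A -> A `<=` H ->
    node_balance v g A = \int[sigma]_(t in A) r t.

Definition flow_conservation (v : V) (g : E -> R -> R) : Prop :=
  net_outflow_rate v g (cst 0).

Definition sd_flow (g : E -> R -> R) : Prop :=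
  [/\ forall e, inLplus tf (g e),
      exists2 r, inLplus tf r & net_outflow_rate s g r,
      forall v, v != s -> v != d -> flow_conservation v g
    & forall A, measurable A -> A `<=` H -> node_balance d g A <= 0].

Definition zero_cycle_inflow (c : seq E) (h : R -> R) : Prop :=
  inLplus tf h /\
  {ae sigma, forall t, H t -> 0 < h t -> forall e, e \in c -> D e u t = 0}.

(* The sum over the walks is the limit in L(H)^E of the net of the sums over
   finite sets F of walks; totally is the filter of the large finite sets. *)
Definition flow_decomposition (g : E -> R -> R) (hw hc : seq E -> R -> R) :
    Prop :=
  exists lw lc : seq E -> E -> R -> R,
  [/\ forall w, walk src dst s d w ->
        inLplus tf (hw w) /\ induced_flow w (hw w) (lw w),
      forall c, simple_cycle src dst c ->
        zero_cycle_inflow c (hc c) /\ induced_flow c (hc c) (lc c)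
    & forall e,
        (fun F : {fset seq E} =>
          \int[sigma]_(t in H)
            `|g e t - (\sum_(w <- F | walk src dst s d w) lw w e t +
              \sum_(c \in [set c | simple_cycle src dst c]) lc c e t)|)
          @ totally --> (0 : R)].

End Flows.

(* Main.v *)
(* Let a particle that reaches a node v at time x leave along the edge e with
   probability p_e(x), the Radon-Nikodym derivative of the outflow g_e with
   respect to the total inflow into v, and stop with the remaining probability
   q_v(x); particles only stop at d. The inflow rate of a walk w is the source
   rate times the probability of following w and then stopping. The inflows
   are stationary for this chain, so the walk flows add up to at most g, and the
   total number of steps has finite expectation, so almost every particle stops
   after finitely many steps. Hence the residual k of g satisfies
   sum_e int k_e phi_(src e) <= sum_e int k_e (phi_(dst e) o T_e) for all
   nonnegative bounded phi. Taking for phi the remaining time tf - x shows that k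
   lives where the edges have no delay; there it is, at almost every time, a
   circulation of the static graph, which is peeled off cycle by cycle. *)
Require Import Defs.
From HB Require Import structures.
From mathcomp Require Import all_boot all_order all_algebra finmap.
From mathcomp Require Import all_classical all_reals all_analysis.
From mathcomp Require Import measurable_realfun summability.
From mathcomp Require Import ring lra.
Set Implicit Arguments.
Unset Strict Implicit.
Unset Printing Implicit Defensive.
Import Order.TTheory GRing.Theory Num.Theory.
Import numFieldNormedType.Exports.
Local Open Scope classical_set_scope.
Local Open Scope ring_scope.

(** * Densities and Radon-Nikodym *)

Section Density.
Local Open Scope ereal_scope.
Context d (T : measurableType d) (R : realType).

Import HBNNSimple.

(** Exit times may be constant on intervals, and at [d] only outflow at most inflow is known, so an
    inflow need not have a Lebesgue density. Inflows are therefore kept as functionals on bounded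
    measurable functions. The [p e] are densities with respect to these functionals, and facts about
    them hold only up to inflow-null sets, hence appear as equations between integrals. The induced
    flow of a walk is a function only once it is known to be dominated by [g e]; bounding the walk
    flows by [g] is thus also what makes them exist. The expected number of nodes visited is at most
    the total inflow mass, so the mass still moving after n steps is O(1/n). This is the only error
    term in the balance of the n-step residual. The limiting inequality suffices: once delays are
    excluded, summing it over the finitely many nodes turns it into an equality. Cycles must be
    removed measurably in time, so all simple cycles are treated in one fixed order that does not
    depend on the time. *)

Lemma ge0_integral_density (nu mu : {measure set T -> \bar R}) (f : T -> R)
    (phi : T -> \bar R) :
  measurable_fun setT f -> (forall x, (0 <= f x)%R) ->
  (forall A, measurable A -> nu A = \int[mu]_(x in A) (f x)%:E) ->
  measurable_fun setT phi -> (forall x, 0 <= phi x) ->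
  \int[nu]_x phi x = \int[mu]_x (phi x * (f x)%:E).
Proof.
move=> mf f0 nuE mphi phi0.
pose h := nnsfun_approx measurableT mphi.
have hphi x : (EFin \o h n) x @[n --> \oo] --> phi x.
  by apply: cvg_nnsfun_approx => // y _; exact: phi0.
have mh n : measurable_fun setT (fun x => (h n x)%:E).
  by apply/measurable_EFinP; exact: measurable_funP.
have hnd x : {homo (fun n => h n x) : m n / (m <= n)%N >-> (m <= n)%R}.
  by move=> m n mn; exact/lefP/nd_nnsfun_approx.
have step n : \int[nu]_x (h n x)%:E = \int[mu]_x ((h n x)%:E * (f x)%:E).
  have mf' : measurable_fun setT (fun x => (f x)%:E) by exact/measurable_EFinP.
  have mind y : measurable_fun setT
      (fun x => (y * \1_(h n @^-1` [set y]) x)%:E).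
    by apply/measurable_EFinP; apply: measurable_funM.
  have ind0 y x : 0 <= (y * \1_(h n @^-1` [set y]) x)%:E.
    exact: nnfun_muleindic_ge0.
  under eq_integral do rewrite fimfunE -fsumEFin//.
  under [RHS]eq_integral => x _.
    rewrite fimfunE -fsumEFin// ge0_mule_fsuml//; over.
  rewrite ge0_integral_fsum//.
  rewrite ge0_integral_fsum//; last 2 first.
  - by move=> y; exact: emeasurable_funM.
  - by move=> y x _; rewrite mule_ge0// lee_fin.
  apply: eq_fsbigr => y yh.
  have y0 : (0 <= y)%R by move: yh; rewrite inE => -[t _ <-].
  rewrite integralZl_indic_nnsfun// integral_indic// setIT nuE//.
  under [RHS]eq_integral do rewrite EFinM -muleA.
  rewrite ge0_integralZl//; last 2 first.
  - by apply: emeasurable_funM => //; apply/measurable_EFinP.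
  - by move=> x _; rewrite mule_ge0// lee_fin.
  congr (_ * _); rewrite integral_mkcond; apply: eq_integral => x _.
  by rewrite /= epatch_indic muleC.
transitivity (limn (fun n => \int[nu]_x (h n x)%:E)).
  rewrite -monotone_convergence//.
  - by apply: eq_integral => x _; apply/esym/cvg_lim => //; exact: hphi.
  - by move=> n x _; rewrite lee_fin.
  - by move=> x _ m n mn; rewrite lee_fin; exact: hnd.
under eq_fun do rewrite step.
rewrite -monotone_convergence//.
- apply: eq_integral => x _; apply/cvg_lim => //.
  by apply: cvgeZr => //; exact: hphi.
- by move=> n; apply: emeasurable_funM => //; exact/measurable_EFinP.
- by move=> n x _; rewrite mule_ge0 ?lee_fin.
- by move=> x _ m n mn; rewrite lee_wpmul2r ?lee_fin//; exact: hnd.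
Qed.

Definition density (mu : {measure set T -> \bar R}) (f : T -> R)
    (mf : measurable_fun setT f) (f0 : forall x, (0 <= f x)%R) (A : set T) :=
  \int[mu]_(x in A) (f x)%:E.

Section density_measure.
Variables (mu : {measure set T -> \bar R}) (f : T -> R).
Variables (mf : measurable_fun setT f) (f0 : forall x, (0 <= f x)%R).
Local Notation nu := (density mu mf f0).

Let nu0 : nu set0 = 0. Proof. by rewrite /density integral_set0. Qed.

Let nu_ge0 A : 0 <= nu A.
Proof. by apply: integral_ge0 => x _; rewrite lee_fin. Qed.

Let nu_sigma_additive : semi_sigma_additive nu.
Proof.
apply: semi_sigma_additive_nng_induced; first exact/measurable_EFinP.
by move=> x; rewrite lee_fin.
Qed.

HB.instance Definition _ := isMeasure.Build _ _ _ nu nu0 nu_ge0 nu_sigma_additive.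
End density_measure.

Lemma integral_densityE (mu : {measure set T -> \bar R}) (f : T -> R)
    (mf : measurable_fun setT f) (f0 : forall x, (0 <= f x)%R)
    (phi : T -> \bar R) :
  measurable_fun setT phi -> (forall x, 0 <= phi x) ->
  \int[density mu mf f0]_x phi x = \int[mu]_x (phi x * (f x)%:E).
Proof. by move=> mphi phi0; apply: ge0_integral_density. Qed.

Definition image_measure (m : {measure set T -> \bar R}) (S : T -> T)
  (mS : measurable_fun setT S) : {measure set T -> \bar R}.
Proof. by refine (pushforward m S); exact: mS. Defined.

Lemma image_measureE m S (mS : measurable_fun setT S) A :
  image_measure m mS A = m (S @^-1` A).
Proof. by []. Qed.

Lemma integral_image_measure m S (mS : measurable_fun setT S)
    (phi : T -> \bar R) :
  measurable_fun setT phi -> (forall x, 0 <= phi x) ->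
  \int[image_measure m mS]_x phi x = \int[m]_x phi (S x).
Proof.
by move=> mphi phi0; rewrite ge0_integral_pushforward// preimage_setT.
Qed.

(** Radon-Nikodym is applied to bundled finite measures; an equality of measures, not merely of
    their values, lets integrals be transported by rewriting. *)
Lemma to_finite_measure (m : {measure set T -> \bar R}) : fin_num_fun m ->
  exists M : {finite_measure set T -> \bar R},
    (M : {measure set T -> \bar R}) = m.
Proof.
move=> fin.
have sfin : sigma_finite setT m.
  by apply: fin_num_fun_sigma_finite; [rewrite measure0|exact: fin].
have sfin' : sfinite_measure m by exact: sfinite_measure_sigma_finite.
pose H1 := isFinite.Build _ _ _ _ fin.
pose H2 := isSFinite.Build _ _ _ _ sfin'.
pose H3 := isSigmaFinite.Build _ _ _ _ sfin.
exists (HB.pack_for (FiniteMeasure.type T R) (Measure.sort m) H1 H2 H3).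
exact: eq_measure.
Qed.

(** Where the derivative exceeds 1, domination squeezes the two measures into equality, so the
    derivative is 1 almost everywhere there and that set is null. Truncating at 1 then costs nothing
    and gives bounds at every point, which pointwise inductions along walks require. *)
Lemma Radon_Nikodym_le (m1 m2 : {measure set T -> \bar R}) :
  m2 setT < +oo -> (forall A, measurable A -> m1 A <= m2 A) ->
  exists th : T -> R, [/\ measurable_fun setT th,
    forall x, (0 <= th x <= 1)%R &
    forall phi : T -> R, measurable_fun setT phi -> (forall x, (0 <= phi x)%R) ->
      \int[m1]_x (phi x)%:E = \int[m2]_x (th x * phi x)%:E].
Proof.
move=> m2fin m12.
have fin1 : fin_num_fun m1.
  move=> A mA; rewrite ge0_fin_numE//.
  apply: (le_lt_trans (m12 _ mA)); apply: le_lt_trans m2fin.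
  by apply: le_measure; rewrite ?inE.
have fin2 : fin_num_fun m2.
  move=> A mA; rewrite ge0_fin_numE//; apply: le_lt_trans m2fin.
  by apply: le_measure; rewrite ?inE.
have [M1 M1E] := to_finite_measure fin1.
have [M2 M2E] := to_finite_measure fin2.
have M1A A : M1 A = m1 A by rewrite -[in RHS]M1E.
have M2A A : M2 A = m2 A by rewrite -[in RHS]M2E.
have dom : M1 `<< M2.
  apply/null_content_dominatesP => A mA A0; apply/eqP.
  rewrite -measure_le0.
  by have := m12 A mA; rewrite -M1A -M2A => /le_trans; apply; rewrite A0.
have [f [f0 ffin fint fE]] := radon_nikodym_sigma_finite dom.
pose g x := fine (f x).
have fg x : (g x)%:E = f x by rewrite /g fineK.
have mg : measurable_fun setT g.
  by apply/measurable_EFinP/(eq_measurable_fun f) => [x _ /=|]; rewrite ?fg//;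
    exact: (measurable_int M2).
have g0 x : (0 <= g x)%R by rewrite fine_ge0.
have gE A : measurable A -> m1 A = \int[m2]_(x in A) (g x)%:E.
  by move=> mA; rewrite -M1A fE// -M2E; apply: eq_integral => x _; rewrite fg.
pose B := [set x | (1 < g x)%R].
have mB : measurable B.
  by rewrite -[B]setTI; apply: measurable_fun_ltr.
have B0 : m2 B = 0.
  have gi : m2.-integrable B (EFin \o g).
    rewrite -M2E; apply: (@integrableS _ _ _ _ setT) => //.
    by apply: eq_integrable fint => // x _ /=; rewrite fg.
  have : ae_eq m2 B (EFin \o g) (cst 1).
    apply: integral_ae_eq => // A AB mA.
    apply/eqP; rewrite eq_le; apply/andP; split.
      by rewrite -gE// integral_cst// mul1e m12.
    apply: ge0_le_integral => //; first exact/measurable_funTS/measurable_EFinP.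
    by move=> x /AB/ltW; rewrite lee_fin.
  move=> [N [mN N0 BN]]; apply/eqP; rewrite -measure_le0 -N0.
  apply: le_measure; rewrite ?inE// => x Bx; apply: BN => /= /(_ Bx) [] gx1.
  by move: Bx; rewrite /B/= gx1 ltxx.
exists (fun x => Num.min (g x) 1)%R; split.
- exact: measurable_minr.
- by move=> x; rewrite le_min ge_min lexx orbT g0 ler01.
- move=> phi mphi phi0.
  have mphi' : measurable_fun setT (EFin \o phi) by exact/measurable_EFinP.
  rewrite (ge0_integral_density mg g0 gE mphi')//.
  apply: ge0_ae_eq_integral => //.
  + by apply: emeasurable_funM => //; exact/measurable_EFinP.
  + by apply/measurable_EFinP/measurable_funM => //; exact: measurable_minr.
  + by move=> x _; rewrite mule_ge0 ?lee_fin.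
  + by move=> x _; rewrite lee_fin mulr_ge0// le_min g0 ler01.
  exists B; split => // x /= /not_implyP[_]; apply: contra_notP.
  by move=> /negP; rewrite -leNgt => gx1; rewrite -EFinM mulrC min_l.
Qed.
End Density.

Section AlmostEverywhere.
Context d (T : measurableType d) (R : realType).
Variable mu : {measure set T -> \bar R}.
Implicit Types P Q : T -> Prop.

Lemma ae_impl P Q : (forall x, P x -> Q x) ->
  {ae mu, forall x, P x} -> {ae mu, forall x, Q x}.
Proof. by move=> PQ; apply: filterS. Qed.

Lemma ae_impl2 P Q (S : T -> Prop) : (forall x, P x -> Q x -> S x) ->
  {ae mu, forall x, P x} -> {ae mu, forall x, Q x} -> {ae mu, forall x, S x}.
Proof. by move=> PQS; apply: filterS2. Qed.

Lemma ae_forall_fin (I : finType) (P : I -> T -> Prop) :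
  (forall i, {ae mu, forall x, P i x}) -> {ae mu, forall x, forall i, P i x}.
Proof.
move=> aeP; apply: (@ae_impl (fun x => forall i, i \in enum I -> P i x)).
  by move=> x h i; apply: h; rewrite mem_enum.
elim: (enum I) => [|i l IHl]; first by apply: aeW.
apply: ae_impl2 (aeP i) IHl => x Pi Pl j.
by rewrite inE => /predU1P[->|/Pl].
Qed.

End AlmostEverywhere.

(** * Measures with integrable density, acting on bounded measurable functions *)

Section Functional.
Context d (T : measurableType d) (R : realType).
Variable mu : {measure set T -> \bar R}.
Implicit Types (f g phi psi : T -> R) (S : T -> T) (A : set T).

Definition bounded_measurable phi :=
  measurable_fun setT phi /\ exists B, forall x, `|phi x| <= B.

(** Nonnegativity is required at every point, not almost everywhere, so that estimates under the
    integral can be made pointwise. *)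
Definition nonneg_integrable f :=
  [/\ measurable_fun setT f, forall x, 0 <= f x & mu.-integrable setT (EFin \o f)].

(** The measure with density [f], tested against [phi]. It is real valued, so that balances can be
    subtracted. *)
Definition wint f phi := \int[mu]_x (f x * phi x).

Local Notation bm := bounded_measurable.
Local Notation nni := nonneg_integrable.
Local Notation J := wint.

Lemma bm_cst a : bm (fun _ => a).
Proof. by split; [exact: measurable_cst|exists `|a|]. Qed.

Lemma bmD phi psi : bm phi -> bm psi -> bm (fun x => phi x + psi x).
Proof.
move=> [mf [B fB]] [mg [C gC]]; split; first exact: measurable_funD.
by exists (B + C) => x; rewrite (le_trans (ler_normD _ _))// lerD.
Qed.

Lemma bmM phi psi : bm phi -> bm psi -> bm (fun x => phi x * psi x).
Proof.
move=> [mf [B fB]] [mg [C gC]]; split; first exact: measurable_funM.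
by exists (B * C) => x; rewrite normrM ler_pM.
Qed.

Lemma bmN phi : bm phi -> bm (fun x => - phi x).
Proof.
move=> [mf [B fB]]; split; first exact: measurable_funN.
by exists B => x; rewrite normrN.
Qed.

Lemma bmB phi psi : bm phi -> bm psi -> bm (fun x => phi x - psi x).
Proof. by move=> bf /bmN; exact: bmD. Qed.

Lemma bm_comp phi S : measurable_fun setT S -> bm phi -> bm (fun x => phi (S x)).
Proof.
move=> mS [mf [B fB]]; split; last by exists B.
exact: measurableT_comp.
Qed.

Lemma bm_sum (I : Type) (r : seq I) (P : pred I) (phi : I -> T -> R) :
  (forall i, P i -> bm (phi i)) -> bm (fun x => \sum_(i <- r | P i) phi i x).
Proof.
move=> bphi; elim: r => [|i r IHr].
  rewrite (_ : (fun x => _) = (fun=> 0)); first exact: bm_cst.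
  by apply/funext => x; rewrite big_nil.
have [Pi|Pi] := boolP (P i); last first.
  rewrite (_ : (fun x => _) = (fun x => \sum_(j <- r | P j) phi j x))//.
  by apply/funext => x; rewrite big_cons (negbTE Pi).
rewrite (_ : (fun x => _) = (fun x => phi i x + \sum_(j <- r | P j) phi j x)).
  by apply: bmD => //; exact: bphi.
by apply/funext => x; rewrite big_cons Pi.
Qed.

Lemma bm_indic A : measurable A -> bm \1_A.
Proof.
move=> mA; split; first exact: measurable_indic.
by exists 1 => x; rewrite indicE; case: (_ \in _); rewrite ?normr1 ?normr0.
Qed.

Lemma nni_int f phi : nni f -> bm phi ->
  mu.-integrable setT (fun x => (f x * phi x)%:E).
Proof.
move=> [mf f0 fi] [mphi [B hB]].
have Bfi : mu.-integrable setT (fun x => (B%:E * (f x)%:E)%E).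
  exact: (integrableZl measurableT B fi).
apply: (le_integrable measurableT _ _ Bfi) => //.
  by apply/measurable_EFinP; exact: measurable_funM.
move=> x _ /=; rewrite lee_fin !normrM mulrC ler_wpM2r//.
by rewrite (le_trans (hB x))// ler_norm.
Qed.

Lemma wintE f phi : nni f -> bm phi ->
  (J f phi)%:E = (\int[mu]_x (f x * phi x)%:E)%E.
Proof.
move=> nf bf; rewrite /J /Rintegral fineK//.
by apply: integrable_fin_num => //; exact: nni_int.
Qed.

Lemma wintD f phi psi : nni f -> bm phi -> bm psi ->
  J f (fun x => phi x + psi x) = J f phi + J f psi.
Proof.
move=> nf b1 b2; rewrite /J -RintegralD//; [|exact: nni_int..].
by apply: eq_Rintegral => x _; rewrite mulrDr.
Qed.

Lemma wintB f phi psi : nni f -> bm phi -> bm psi ->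
  J f (fun x => phi x - psi x) = J f phi - J f psi.
Proof.
move=> nf b1 b2; rewrite /J -RintegralB//; [|exact: nni_int..].
by apply: eq_Rintegral => x _; rewrite mulrBr.
Qed.

Lemma wintZ f phi a : nni f -> bm phi -> J f (fun x => a * phi x) = a * J f phi.
Proof.
move=> nf b1; rewrite /J -RintegralZl//; last exact: nni_int.
by apply: eq_Rintegral => x _; rewrite mulrCA.
Qed.

Lemma wint0 f : J f (fun _ => 0) = 0.
Proof.
rewrite /J /Rintegral (_ : (fun x => _) = cst 0%E) ?integral0//.
by apply/funext => x; rewrite mulr0.
Qed.

Lemma eq_wint f phi psi : phi =1 psi -> J f phi = J f psi.
Proof. by move=> h; congr J; exact/funext. Qed.

Lemma wint_sum f (I : Type) (r : seq I) (P : pred I) (phi : I -> T -> R) :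
  nni f -> (forall i, P i -> bm (phi i)) ->
  J f (fun x => \sum_(i <- r | P i) phi i x) = \sum_(i <- r | P i) J f (phi i).
Proof.
move=> nf bphi; elim: r => [|i r IHr].
  rewrite big_nil (_ : (fun x => _) = (fun=> 0)) ?wint0//.
  by apply/funext => x; rewrite big_nil.
rewrite big_cons -IHr; have [Pi|Pi] := boolP (P i); last first.
  by apply: eq_wint => x; rewrite big_cons (negbTE Pi).
rewrite -wintD//; [|exact: bphi|exact: bm_sum].
by apply: eq_wint => x; rewrite big_cons Pi.
Qed.

Lemma wint_le f phi psi : nni f -> bm phi -> bm psi ->
  (forall x, phi x <= psi x) -> J f phi <= J f psi.
Proof.
move=> nf b1 b2 h; apply: le_Rintegral => //; [exact: nni_int..|].
by move=> x _; apply: ler_wpM2l => //; case: nf.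
Qed.

Lemma wint_ge0 f phi : nni f -> (forall x, 0 <= phi x) -> 0 <= J f phi.
Proof. by move=> [_ f0 _] h; apply: Rintegral_ge0 => x _; rewrite mulr_ge0. Qed.

(* Every bounded function is a difference of nonnegative bounded functions,
   one of them constant. *)
Lemma bm_ext (F G : (T -> R) -> R) :
  (forall phi psi, bm phi -> bm psi ->
     F (fun x => phi x - psi x) = F phi - F psi) ->
  (forall phi psi, bm phi -> bm psi ->
     G (fun x => phi x - psi x) = G phi - G psi) ->
  (forall phi, bm phi -> (forall x, 0 <= phi x) -> F phi = G phi) ->
  forall phi, bm phi -> F phi = G phi.
Proof.
move=> FB GB FG phi bphi; have [mphi [B hB]] := bphi.
have bB : bm (fun _ => `|B|) by exact: bm_cst.
have bDB : bm (fun x => phi x + `|B|) by exact: bmD.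
rewrite (_ : phi = fun x => phi x + `|B| - `|B|); last first.
  by apply/funext => x; rewrite addrK.
rewrite FB// GB// !FG// => x.
rewrite -lerBlDr sub0r; have := hB x; rewrite ler_norml => /andP[+ _].
by apply: le_trans; rewrite lerN2 ler_norm.
Qed.

Section RadonNikodym.
Variables (I : finType) (f : I -> T -> R) (S : I -> T -> T).
Hypotheses (nf : forall i, nni (f i)) (mS : forall i, measurable_fun setT (S i)).

Let mf i : measurable_fun setT (f i). Proof. by case: (nf i). Qed.
Let f0 i x : 0 <= f i x. Proof. by case: (nf i). Qed.

(** [msum] adds measures indexed by natural numbers, hence the enumeration of [I]; indices beyond
    its cardinal get the zero measure. *)
Let m (n : nat) : {measure set T -> \bar R} :=
  if (insub n : option 'I_#|I|) is Some i then
    image_measure (density mu (mf (enum_val i)) (f0 (enum_val i)))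
      (mS (enum_val i))
  else mzero.

Let integral_m phi : bm phi -> (forall x, 0 <= phi x) ->
  (\int[msum m #|I|]_x (phi x)%:E)%E =
  (\sum_i J (f i) (fun x => phi (S i x)))%:E.
Proof.
move=> bphi phi0; have mphi := bphi.1.
rewrite ge0_integral_measure_sum//; last 2 first.
  by move=> x _; rewrite lee_fin.
  exact/measurable_EFinP.
rewrite -sumEFin (reindex (@enum_val I predT)) /=; last first.
  by apply: onW_bij; exact: enum_val_bij.
apply: eq_bigr => i _; rewrite /m valK.
rewrite integral_image_measure//; last exact/measurable_EFinP.
rewrite integral_densityE//.
  rewrite wintE//; last exact: (bm_comp (mS _)).
  by apply: eq_integral => x _ /=; rewrite mulrC.
- by apply/measurable_EFinP; apply: measurableT_comp.
- by move=> x; rewrite lee_fin.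
Qed.

(** The reference measure is the sum of the images of the densities [f i] under [S i], which may be
    singular to [mu]. The derivative lives at the arrival point, which is why [th] is evaluated at
    [S i x]. *)
Lemma Radon_Nikodym_sum g : nni g ->
  (forall A, measurable A -> J g \1_A <= \sum_i J (f i) (fun x => \1_A (S i x))) ->
  exists th, [/\ bm th, forall x, 0 <= th x <= 1 &
    forall phi, bm phi ->
      J g phi = \sum_i J (f i) (fun x => th (S i x) * phi (S i x))].
Proof.
move=> ng gle; have [mg g0 gi] := ng.
have gE A : measurable A -> density mu mg g0 A = (J g \1_A)%:E.
  move=> mA; rewrite wintE//; last exact: bm_indic.
  rewrite /density integral_mkcond; apply: eq_integral => x _.
  by rewrite /= epatch_indic -EFinM.
have mE A : measurable A ->
    msum m #|I| A = (\sum_i J (f i) (fun x => \1_A (S i x)))%:E.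
  move=> mA; rewrite -integral_m//; last exact: bm_indic.
  by rewrite integral_indic// setIT.
have [|A mA|th [mth th01 thE]] := @Radon_Nikodym_le _ _ _ (density mu mg g0)
    (msum m #|I|).
- by rewrite [ltLHS]mE// ltry.
- by rewrite [leLHS]gE// [leRHS]mE// lee_fin; exact: gle.
have bth : bm th.
  by split => //; exists 1 => x; rewrite ger0_norm; have /andP[] := th01 x.
exists th; split => //.
apply: bm_ext.
- by move=> phi psi bphi bpsi; rewrite wintB.
- move=> phi psi bphi bpsi; rewrite -sumrB; apply: eq_bigr => i _.
  rewrite -wintB//; last 2 first.
    exact: (bm_comp (mS i) (bmM bth _)).
    exact: (bm_comp (mS i) (bmM bth _)).
  by apply: eq_wint => x; rewrite mulrBr.
- move=> phi bphi phi0.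
  have thphi0 x : 0 <= th x * phi x.
    by rewrite mulr_ge0//; have /andP[] := th01 x.
  apply: EFin_inj; have /= <- := integral_m (bmM bth bphi) thphi0.
  rewrite -thE//; last by case: bphi.
  rewrite integral_densityE//.
  + by rewrite wintE//; apply: eq_integral => x _; rewrite -EFinM mulrC.
  + by apply/measurable_EFinP; case: bphi.
Qed.

End RadonNikodym.

(** Domination by the measure of density [g] excludes a singular part of the image. The density is
    [g] times the derivative of the image with respect to that measure. *)
Lemma density_pushforward f g S : nni f -> nni g -> measurable_fun setT S ->
  (forall A, measurable A -> J f (fun x => \1_A (S x)) <= J g \1_A) ->
  exists2 l, nni l & forall phi, bm phi -> J f (fun x => phi (S x)) = J l phi.
Proof.
move=> nf ng mS fg; have [mf f0 fi] := nf; have [mg g0 gi] := ng.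
have [|A mA|th [mth th01 thE]] := @Radon_Nikodym_le _ _ _
    (image_measure (density mu mf f0) mS) (density mu mg g0).
- have := nni_int ng (bm_cst 1); rewrite /density => /integrable_lty.
  by under eq_integral do rewrite mulr1; apply.
- have e1 : density mu mg g0 A = (J g \1_A)%:E.
    rewrite wintE//; last exact: bm_indic.
    rewrite /density integral_mkcond; apply: eq_integral => x _.
    by rewrite /= epatch_indic -EFinM.
  have e2 : density mu mf f0 (S @^-1` A) = (J f (fun x => \1_A (S x)))%:E.
    rewrite wintE//; last by apply: bm_comp => //; exact: bm_indic.
    rewrite /density integral_mkcond; apply: eq_integral => x _.
    by rewrite /= epatch_indic -EFinM.
  rewrite image_measureE [leLHS]e2 [leRHS]e1.
  by rewrite lee_fin; exact: fg.
have bth : bm th.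
  by split => //; exists 1 => x; rewrite ger0_norm; have /andP[] := th01 x.
have nl : nni (fun x => th x * g x).
  split; first exact: measurable_funM.
  + by move=> x; rewrite mulr_ge0//; have /andP[] := th01 x.
  + by under eq_fun do rewrite mulrC; exact: nni_int.
exists (fun x => th x * g x) => //.
apply: bm_ext.
- by move=> phi psi bphi bpsi; rewrite wintB//; apply: bm_comp.
- by move=> phi psi bphi bpsi; rewrite wintB.
- move=> phi bphi phi0; have mphi := bphi.1.
  have := thE _ mphi phi0.
  have mphiE : measurable_fun setT (EFin \o phi) by exact/measurable_EFinP.
  rewrite integral_image_measure// integral_densityE//; last 2 first.
    by apply/measurable_EFinP; apply: measurableT_comp.
    by move=> x; rewrite lee_fin.
  rewrite integral_densityE//; last 2 first.
    by apply/measurable_EFinP; apply: measurable_funM.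
    by move=> x; rewrite lee_fin mulr_ge0//; have /andP[] := th01 x.
  move=> fgE; apply: EFin_inj; rewrite !wintE//; last exact: bm_comp.
  under eq_integral do rewrite mulrC EFinM.
  rewrite [LHS]fgE; apply: eq_integral => x _.
  by rewrite -EFinM mulrAC.
Qed.

End Functional.
Arguments bm_cst {d T R} a.

(** * Walks and the Markov chain *)

Section Walks.
Context {V E : finType} (src dst : E -> V).

(** Unlike [walk], this admits the empty walk, which is the base case of every first-step recursion
    and describes a particle that stops at once. *)
Fixpoint walk_from (v : V) (w : seq E) : bool :=
  if w is e :: w' then (src e == v) && walk_from (dst e) w' else true.

Definition endpoint (v : V) (w : seq E) : V := last v (map dst w).

(** Enumeration by the first edge makes sums over walks obey the recursion of the chain. The length
    bound is strict, so there is no walk for [n = 0]. *)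
Fixpoint walks_lt (n : nat) (v : V) : seq (seq E) :=
  if n is n'.+1 then
    [::] :: [seq e :: w | e <- [seq e <- enum E | src e == v],
                          w <- walks_lt n' (dst e)]
  else [::].

Lemma sum_walks_ltS (A : nmodType) n v (F : seq E -> A) :
  \sum_(w <- walks_lt n.+1 v) F w =
  F [::] + \sum_(e | src e == v) \sum_(w <- walks_lt n (dst e)) F (e :: w).
Proof.
by rewrite /= big_cons big_allpairs_dep /= big_filter big_enum_cond.
Qed.

Lemma mem_walks_lt n v w :
  (w \in walks_lt n v) = walk_from v w && (size w < n)%N.
Proof.
elim: n v w => [|n IHn] v [|e w] //=; first by rewrite in_nil andbF.
rewrite in_cons /=; apply/allpairsPdep/idP => [[e' [w' []]]|].
  rewrite mem_filter IHn => /andP[ve' _] /andP[pw' sw'] [-> ->].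
  by rewrite ve' pw' ltnS.
rewrite ltnS => /andP[/andP[ve pw] sw]; exists e, w.
by rewrite mem_filter ve mem_enum IHn pw sw.
Qed.

Lemma uniq_walks_lt n v : uniq (walks_lt n v).
Proof.
elim: n v => [//|n IHn] v /=; apply/andP; split.
  by apply/negP => /allpairsPdep [e [w [_ _]]].
apply: allpairs_uniq_dep.
- by rewrite filter_uniq// enum_uniq.
- by move=> e _; exact: IHn.
- by move=> [e w] [e' w'] _ _ /= [-> ->].
Qed.

Lemma walk_walk_from v v' w :
  walk src dst v v' w = [&& w != [::], walk_from v w & endpoint v w == v'].
Proof.
case: w => [//|e w] /=; rewrite /endpoint /= andbA last_map; congr (_ && _).
congr (_ && _).
elim: w e => [//|e' w IHw] e /=.
by rewrite IHw eq_sym.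
Qed.

End Walks.
#[local] Arguments walks_lt : simpl never.

(** * The chain of particles and its stationary inflows *)

Section MarkovChain.
Context d (T : measurableType d) (R : realType).
Variable mu : {measure set T -> \bar R}.
Context {V E : finType} (src dst : E -> V) (s t : V) (S : E -> T -> T).
Variables (r : T -> R) (g : E -> T -> R).

Local Notation bm := bounded_measurable.
Local Notation nni := (nonneg_integrable mu).
Local Notation J := (wint mu).

Hypotheses (mS : forall e, measurable_fun setT (S e)).
Hypotheses (nr : nni r) (ng : forall e, nni (g e)).

(* The mass that reaches the node v (from the source or through an edge),
   tested against phi. *)
Definition node_inflow (v : V) (phi : T -> R) : R :=
  (if v == s then J r phi else 0) +
  \sum_(e | dst e == v) J (g e) (fun x => phi (S e x)).

Local Notation M := node_inflow.

Lemma nni0 : nni (fun _ => 0).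
Proof.
split => //; exact: integrable0.
Qed.

Lemma nni_sum (I : finType) (P : pred I) (f : I -> T -> R) :
  (forall i, nni (f i)) -> nni (fun x => \sum_(i | P i) f i x).
Proof.
move=> nf; split.
- rewrite (_ : (fun x => _) =
      (fun x => \sum_i (if P i then f i else fun=> 0) x)); last first.
    by apply/funext => x; rewrite big_mkcond; apply: eq_bigr => i _; case: ifP.
  by apply: measurable_sum => i; case: (P i); [case: (nf i)|].
- by move=> x; apply: sumr_ge0 => i _; case: (nf i).
- rewrite (_ : EFin \o _ = fun x => (\sum_(i | P i) (f i x)%:E)%E); last first.
    by apply/funext => x /=; rewrite sumEFin.
  by apply: integrable_sum => // i _; case: (nf i).
Qed.

Lemma wint_suml (I : finType) (P : pred I) (f : I -> T -> R) phi :
  (forall i, nni (f i)) -> bm phi ->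
  J (fun x => \sum_(i | P i) f i x) phi = \sum_(i | P i) J (f i) phi.
Proof.
move=> nf bphi; apply: EFin_inj; rewrite wintE//; last exact: nni_sum.
rewrite -sumEFin; under [RHS]eq_bigr do rewrite wintE//.
rewrite -integral_sum//; last by move=> i; exact: nni_int.
by apply: eq_integral => x _; rewrite sumEFin mulr_suml.
Qed.

Lemma wint_mul f h phi : J (fun x => f x * h x) phi = J f (fun x => h x * phi x).
Proof. by apply: eq_Rintegral => x _; rewrite mulrA. Qed.

(* At every node v, total outflow = Theta * inflow for a [0, 1]-valued Theta
   by Radon-Nikodym; the probability of continuing on e is Theta times the
   share of g e in the total outflow. *)
Lemma transition_probabilities :
  (forall v A, measurable A ->
     \sum_(e | src e == v) J (g e) \1_A <= M v \1_A) ->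
  exists p : E -> T -> R, [/\ forall e, bm (p e), forall e x, 0 <= p e x,
    forall v x, \sum_(e | src e == v) p e x <= 1 &
    forall e phi, bm phi -> J (g e) phi = M (src e) (fun x => p e x * phi x)].
Proof.
move=> bal.
pose G v x := \sum_(e | src e == v) g e x.
have nG v : nni (G v) by exact: nni_sum.
(* [None] stands for the source, moved by the identity, so that source and incoming edges form one
   finite family. *)
pose f v (i : option E) : T -> R :=
  if i is Some e then (if dst e == v then g e else fun=> 0)
  else (if v == s then r else fun=> 0).
pose S' (i : option E) : T -> T := if i is Some e then S e else idfun.
have nf v i : nni (f v i).
  by case: i => [e|] /=; case: ifP => // _; exact: nni0.
have mS' i : measurable_fun setT (S' i).
  by case: i => [e|]; [exact: mS|exact: measurable_id].
have J0l phi : J (fun=> 0) phi = 0.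
  transitivity (J phi (fun=> 0)); last exact: wint0.
  by apply: eq_Rintegral => x _; rewrite mul0r mulr0.
have ME v phi : \sum_i J (f v i) (fun x => phi (S' i x)) = M v phi.
  rewrite /M big_mkcond/= [RHS]addrC (bigD1 None)//= addrC; congr (_ + _).
    rewrite (reindex_omap Some id) => [|[e|]//]; rewrite [RHS]big_mkcond /=.
    apply: eq_big => [e|e _]; first by rewrite eqxx.
    by case: ifP.
  by case: ifP.
have /choice[th hth] v : exists th, [/\ bm th, forall x, 0 <= th x <= 1 &
    forall phi, bm phi -> J (G v) phi = M v (fun x => th x * phi x)].
  have [|th [bth th01 thE]] := Radon_Nikodym_sum (nf v) mS' (nG v).
    move=> A mA; rewrite wint_suml//; last exact: bm_indic.
    by rewrite (ME v \1_A); exact: bal.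
  exists th; split => // phi bphi; rewrite thE//.
  by rewrite (ME v (fun x => th x * phi x)).
have thE v := let: And3 _ _ h := hth v in h.
have th01 v x : 0 <= th v x <= 1 by case: (hth v).
have bth v : bm (th v) by case: (hth v).
have g0 e x : 0 <= g e x by case: (ng e).
have G0 v x : 0 <= G v x by case: (nG v).
have gG e x : g e x <= G (src e) x.
  by rewrite /G (bigD1 e)//= lerDl sumr_ge0.
(* Division by 0 yields 0: the share vanishes where nothing leaves the node, and there [g e]
   vanishes as well. *)
pose rat e x := g e x / G (src e) x.
have rat0 e x : 0 <= rat e x by rewrite divr_ge0.
have rat1 e x : rat e x <= 1.
  rewrite /rat; have := G0 (src e) x; rewrite le_eqVlt => /predU1P[<-|Gp].
    by rewrite invr0 mulr0.
  by rewrite ler_pdivrMr// mul1r.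
have brat e : bm (rat e).
  split; last by exists 1 => x; rewrite ger0_norm.
  apply: measurable_funM; first by case: (ng e).
  (* The inverse is written as a power, whose measurability is known; the two agree because [G] is
     nonnegative. *)
  rewrite (_ : (fun x => _) = (fun x => G (src e) x `^ (-1))).
    have mG : measurable_fun setT (G (src e)) by case: (nG (src e)).
    exact: (measurableT_comp (measurable_powR _) mG).
  by apply/funext => x; rewrite powR_inv1.
have ratE e phi : J (g e) phi = J (G (src e)) (fun x => rat e x * phi x).
  apply: eq_Rintegral => x _; rewrite mulrA; congr (_ * _).
  have [G0x|Gn0] := eqVneq (G (src e) x) 0; last by rewrite /rat mulrC divfK.
  by rewrite G0x mul0r; apply/eqP; rewrite eq_le g0 andbT -G0x.
exists (fun e x => th (src e) x * rat e x); split.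
- by move=> e; exact: bmM.
- by move=> e x; rewrite mulr_ge0//; have /andP[] := th01 (src e) x.
- move=> v x; have /andP[h0 h1] := th01 v x.
  rewrite (eq_bigr (fun e => th v x * (g e x / G v x))); last first.
    by move=> e /eqP <-.
  rewrite -mulr_sumr -mulr_suml -/(G v x).
  have [->|Gn0] := eqVneq (G v x) 0; first by rewrite mul0r mulr0 ler01.
  by rewrite divff// mulr1.
- move=> e phi bphi; rewrite ratE thE//; last exact: bmM.
  by congr M; apply/funext => x; rewrite mulrA.
Qed.

Variable p : E -> T -> R.
Hypotheses (bp : forall e, bm (p e)) (p0 : forall e x, 0 <= p e x).
Hypothesis p1 : forall v x, \sum_(e | src e == v) p e x <= 1.
Hypothesis pE : forall e phi, bm phi ->
  J (g e) phi = M (src e) (fun x => p e x * phi x).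

Definition stop_probability (v : V) (x : T) : R :=
  1 - \sum_(e | src e == v) p e x.
Local Notation q := stop_probability.

Hypothesis q_null : forall v, v != t -> M v (q v) = 0.

(** For a particle at time [x] at the start of [w]: the expectation of [phi] at its arrival time, on
    the event that it follows [w]. *)
Fixpoint follow (w : seq E) (phi : T -> R) (x : T) : R :=
  if w is e :: w' then p e x * follow w' phi (S e x) else phi x.
Local Notation K := follow.

Fixpoint arrive (w : seq E) (x : T) : T :=
  if w is e :: w' then arrive w' (S e x) else x.

(** Each edge is charged at the time it is entered. Weighted by the inflow rate of [w], this is the
    flow induced by [w], tested against [c]. *)
Fixpoint visits (w : seq E) (c : E -> T -> R) (x : T) : R :=
  if w is e :: w' then c e x + visits w' c (S e x) else 0.

(** The expected sum of [psi] over the first [n] nodes reached, the starting node included: a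
    truncated Green function of the chain. *)
Definition reward (n : nat) (psi : V -> T -> R) (v : V) (x : T) : R :=
  \sum_(w <- walks_lt src dst n v) K w (psi (endpoint dst v w)) x.
Local Notation Y := reward.

(** The probability of taking at least [n] edges, that is, what walks with fewer than [n] edges
    miss. *)
Fixpoint survival (n : nat) (v : V) (x : T) : R :=
  if n is n'.+1 then \sum_(e | src e == v) p e x * survival n' (dst e) (S e x)
  else 1.
Local Notation U := survival.

Lemma bm_stop_probability v : bm (q v).
Proof. by apply: bmB; [exact: bm_cst|exact: bm_sum]. Qed.

Lemma stop_probability_ge0 v x : 0 <= q v x. Proof. by rewrite subr_ge0. Qed.

Lemma bm_follow w phi : bm phi -> bm (K w phi).
Proof.
elim: w phi => [//|e w IHw] phi bphi; apply: bmM => //.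
exact: (bm_comp (mS e) (IHw _ bphi)).
Qed.

Lemma follow_ge0 w phi x : (forall x, 0 <= phi x) -> 0 <= K w phi x.
Proof.
move=> phi0; elim: w x => [//|e w IHw] x /=; exact: mulr_ge0.
Qed.

Lemma measurable_arrive w : measurable_fun setT (arrive w).
Proof.
elim: w => [|e w IHw]; first exact: measurable_id.
exact: (measurableT_comp IHw (mS e)).
Qed.

Lemma bm_visits w c : (forall e, bm (c e)) -> bm (visits w c).
Proof.
move=> bc; elim: w => [|e w IHw]; first exact: bm_cst.
by apply: bmD => //; exact: (bm_comp (mS e) IHw).
Qed.

Lemma visits_ge0 w c x : (forall e x, 0 <= c e x) -> 0 <= visits w c x.
Proof.
by move=> c0; elim: w x => [//|e w IHw] x /=; rewrite addr_ge0.
Qed.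

Lemma follow_mul w phi psi x :
  K w phi x * psi (arrive w x) = K w (fun y => phi y * psi y) x.
Proof. by elim: w x => [//|e w IHw] x /=; rewrite -mulrA IHw. Qed.

Lemma visitsE w c x e0 :
  visits w c x = \sum_(j < size w) c (nth e0 w j) (arrive (take j w) x).
Proof.
elim: w x => [|e w IHw] x /=; first by rewrite big_ord0.
by rewrite big_ord_recl /= IHw.
Qed.

(** An intermediate node is the head of one edge and the tail of the next at the same time, so only
    the two ends of the walk remain. *)
Lemma visits_telescope v w (phi : V -> T -> R) x : walk_from src dst v w ->
  visits w (fun e => phi (src e)) x + phi (endpoint dst v w) (arrive w x) =
  phi v x + visits w (fun e y => phi (dst e) (S e y)) x.
Proof.
elim: w v x => [|e w IHw] v x /=; first by rewrite add0r addr0.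
by move=> /andP[/eqP <- pw]; rewrite -addrA [X in _ + X]IHw// addrA.
Qed.

Lemma rewardS n psi v x : Y n.+1 psi v x =
  psi v x + \sum_(e | src e == v) p e x * Y n psi (dst e) (S e x).
Proof.
rewrite /Y sum_walks_ltS; congr (_ + _).
by apply: eq_bigr => e _; rewrite mulr_sumr.
Qed.

Lemma bm_reward n psi v : (forall v, bm (psi v)) -> bm (Y n psi v).
Proof. by move=> bpsi; apply: bm_sum => w _; exact: bm_follow. Qed.

Lemma reward_ge0 n psi v x : (forall v x, 0 <= psi v x) -> 0 <= Y n psi v x.
Proof. by move=> psi0; apply: sumr_ge0 => w _; exact: follow_ge0. Qed.

Lemma reward_leS n psi v x : (forall v x, 0 <= psi v x) ->
  Y n psi v x <= Y n.+1 psi v x.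
Proof.
move=> psi0; elim: n v x => [|n IHn] v x.
  by rewrite {1}/Y big_nil reward_ge0.
rewrite rewardS (rewardS n.+1) lerD2l; apply: ler_sum => e _.
exact: ler_wpM2l.
Qed.

Lemma node_inflow_le v phi psi : bm phi -> bm psi -> (forall x, phi x <= psi x) ->
  M v phi <= M v psi.
Proof.
move=> b1 b2 h; apply: lerD; first by case: ifP => // _; exact: wint_le.
by apply: ler_sum => e _; apply: wint_le => //; exact: bm_comp.
Qed.

Lemma node_inflowD v phi psi : bm phi -> bm psi ->
  M v (fun x => phi x + psi x) = M v phi + M v psi.
Proof.
move=> b1 b2; rewrite /M addrACA -big_split /=; congr (_ + _).
  by case: ifP => _; rewrite ?addr0// wintD.
apply: eq_bigr => e _; rewrite -wintD//.
  exact: (bm_comp (mS e) b1).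
exact: (bm_comp (mS e) b2).
Qed.

Lemma node_inflow0 v : M v (fun _ => 0) = 0.
Proof.
rewrite /M wint0 if_same add0r big1// => e _.
by rewrite wint0.
Qed.

Lemma node_inflow_sum v (I : Type) (l : seq I) (P : pred I) (phi : I -> T -> R) :
  (forall i, P i -> bm (phi i)) ->
  M v (fun x => \sum_(i <- l | P i) phi i x) = \sum_(i <- l | P i) M v (phi i).
Proof.
move=> bphi; elim: l => [|i l IHl].
  rewrite big_nil (_ : (fun x => _) = (fun=> 0)) ?node_inflow0//.
  by apply/funext => x; rewrite big_nil.
rewrite big_cons -IHl; have [Pi|Pi] := boolP (P i); last first.
  by congr M; apply/funext => x; rewrite big_cons (negbTE Pi).
rewrite -node_inflowD; [|exact: bphi|exact: bm_sum].
by congr M; apply/funext => x; rewrite big_cons Pi.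
Qed.

Lemma node_inflow_ge0 v phi : (forall x, 0 <= phi x) -> 0 <= M v phi.
Proof.
move=> phi0; apply: addr_ge0; first by case: ifP => // _; exact: wint_ge0.
by apply: sumr_ge0 => e _; exact: wint_ge0.
Qed.

Lemma sum_dst (F : E -> V -> R) :
  \sum_v \sum_(e | dst e == v) F e v = \sum_e F e (dst e).
Proof.
rewrite (exchange_big_dep xpredT)//=; apply: eq_bigr => e _.
by rewrite (eq_bigl (pred1 (dst e))) ?big_pred1_eq// => v; rewrite eq_sym.
Qed.

Lemma sum_src (F : E -> V -> R) :
  \sum_v \sum_(e | src e == v) F e v = \sum_e F e (src e).
Proof.
rewrite (exchange_big_dep xpredT)//=; apply: eq_bigr => e _.
by rewrite (eq_bigl (pred1 (src e))) ?big_pred1_eq// => v; rewrite eq_sym.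
Qed.

Lemma sum_node_inflow (f : V -> T -> R) :
  \sum_v M v (f v) = J r (f s) + \sum_e J (g e) (fun x => f (dst e) (S e x)).
Proof.
rewrite big_split /= -big_mkcond /= big_pred1_eq; congr (_ + _).
exact: (sum_dst (fun e v => J (g e) (fun x => f v (S e x)))).
Qed.

(** Stationarity: sending the node inflows through the transition probabilities reproduces [g], so
    an expected one-step cost under the inflows is the cost under [g]. *)
Lemma sum_node_inflow_transition (c : E -> T -> R) : (forall e, bm (c e)) ->
  \sum_v M v (fun x => \sum_(e | src e == v) p e x * c e x) =
  \sum_e J (g e) (c e).
Proof.
move=> bc.
rewrite (eq_bigr (fun v => \sum_(e | src e == v) M v (fun x => p e x * c e x))).
  rewrite (sum_src (fun e v => M v (fun x => p e x * c e x))).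
  by apply: eq_bigr => e _; rewrite pE.
by move=> v _; rewrite node_inflow_sum// => e _; exact: bmM.
Qed.

(* Comparing the rewards of n and n + 1 steps started from the stationary
   inflows M, everything but the rewards at the first node cancels. *)
Lemma reward_le n psi : (forall v, bm (psi v)) -> (forall v x, 0 <= psi v x) ->
  J r (Y n psi s) <= \sum_v M v (psi v).
Proof.
move=> bpsi psi0.
have bY k v : bm (Y k psi v) by exact: bm_reward.
have h1 := sum_node_inflow (Y n psi).
have h2 : \sum_v M v (Y n psi v) <= \sum_v M v (Y n.+1 psi v).
  by apply: ler_sum => v _; apply: node_inflow_le => // x; exact: reward_leS.
have h3 : \sum_v M v (Y n.+1 psi v) = \sum_v M v (psi v) +
    \sum_e J (g e) (fun x => Y n psi (dst e) (S e x)).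
  rewrite -sum_node_inflow_transition; last first.
    by move=> e; exact: (bm_comp (mS e) (bY _ _)).
  rewrite -big_split; apply: eq_bigr => v _ /=; rewrite -node_inflowD//; last first.
    apply: bm_sum => e _; apply: bmM => //.
    exact: (bm_comp (mS e) (bY _ _)).
  by congr M; apply/funext => x; rewrite rewardS.
by move: h2; rewrite h1 h3 lerD2r.
Qed.

Lemma bm_survival n v : bm (U n v).
Proof.
elim: n v => [|n IHn] v; first exact: bm_cst.
apply: bm_sum => e _; apply: bmM => //.
exact: (bm_comp (mS e) (IHn _)).
Qed.

Lemma survival_ge0 n v x : 0 <= U n v x.
Proof.
by elim: n v x => [//|n IHn] v x /=; apply: sumr_ge0 => e _; exact: mulr_ge0.
Qed.

Lemma survival_leS n v x : U n.+1 v x <= U n v x.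
Proof.
elim: n v x => [|n IHn] v x.
  rewrite /= (eq_bigr (fun e => p e x)) => [|e _]; first exact: p1.
  by rewrite mulr1.
by apply: ler_sum => e _; apply: ler_wpM2l => //; exact: IHn.
Qed.

(** A particle either stops after fewer than [n] edges or takes at least [n] of them. *)
Lemma reward_stop_probability n v x : Y n q v x = 1 - U n v x.
Proof.
elim: n v x => [|n IHn] v x; first by rewrite /Y big_nil subrr.
rewrite rewardS (eq_bigr (fun e => p e x - p e x * U n (dst e) (S e x))).
  rewrite sumrB -[RHS]/(1 - \sum_(e | src e == v) p e x * U n (dst e) (S e x)).
  by rewrite /stop_probability addrA subrK.
by move=> e _; rewrite IHn mulrBr mulr1.
Qed.

(** The reward of the constant 1 is the sum of the survival probabilities for all m < n, and these
    decrease in m. *)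
Lemma reward1_ge n v x : n%:R * U n v x <= Y n (fun _ _ => 1) v x.
Proof.
elim: n v x => [|n IHn] v x; first by rewrite mul0r /Y big_nil.
have h : n%:R * U n.+1 v x <=
    \sum_(e | src e == v) p e x * Y n (fun _ _ => 1) (dst e) (S e x).
  rewrite /= mulr_sumr; apply: ler_sum => e _.
  by rewrite mulrCA; apply: ler_wpM2l.
have U1 m : U m v x <= 1.
  by elim: m => [//|m]; apply: le_trans; exact: survival_leS.
rewrite rewardS -natr1 mulrDl mul1r addrC; exact: lerD.
Qed.

(** Markov's inequality for the number of steps, whose truncated expectation is bounded by the total
    inflow mass through [reward_le]. *)
Lemma survival_le n : n%:R * J r (U n s) <= \sum_v M v (fun _ => 1).
Proof.
rewrite -wintZ//; last exact: bm_survival.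
apply: le_trans (reward_le n _ _) => //; last first.
  by move=> v; exact: bm_cst.
apply: wint_le => //.
- by apply: bmM; [exact: bm_cst|exact: bm_survival].
- by apply: bm_reward => v; exact: bm_cst.
- by move=> x; exact: reward1_ge.
Qed.

(** * Flows of the walks from [s] to [t]: upper bound and balance *)

Local Notation W n := [seq w <- walks_lt src dst n s | endpoint dst s w == t].
Local Notation h w := (K w (q t)).

Lemma sum_st_walks_le (F : seq E -> R) (G : seq E -> R) n :
  (forall w, walk_from src dst s w -> endpoint dst s w = t -> F w = G w) ->
  (forall w, 0 <= G w) ->
  \sum_(w <- W n) F w <= \sum_(w <- walks_lt src dst n s) G w.
Proof.
move=> FG G0; rewrite big_filter big_mkcond big_seq [leRHS]big_seq.
apply: ler_sum => w; rewrite mem_walks_lt => /andP[pw _].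
by case: eqP => // wt; rewrite FG.
Qed.

(** Charging [c] along all paths, not only along those that stop at [t] in time, can only increase
    the cost, and [reward_le] bounds the cost of all paths by that of [g]. For [c] supported on one
    edge this places the walk flows below [g]. *)
Lemma walk_flow_le n c : (forall e, bm (c e)) -> (forall e x, 0 <= c e x) ->
  \sum_(w <- W n) J r (fun x => h w x * visits w c x) <= \sum_e J (g e) (c e).
Proof.
move=> bc c0.
(* [Z] is the expected cost of the walks that stop after fewer than [n] edges, and [psi] below is
   the expected cost of the next edge. *)
pose Z n v x := \sum_(w <- walks_lt src dst n v)
  K w (q (endpoint dst v w)) x * visits w c x.
pose psi v x := \sum_(e | src e == v) p e x * c e x.
have psi0 v x : 0 <= psi v x by apply: sumr_ge0 => e _; rewrite mulr_ge0.
have bpsi v : bm (psi v) by apply: bm_sum => e _; exact: bmM.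
have bZ m v : bm (Z m v).
  apply: bm_sum => w _; apply: bmM; last exact: bm_visits.
  by apply: bm_follow; exact: bm_stop_probability.
have ZY m v x : Z m v x <= Y m psi v x.
  elim: m v x => [|m IHm] v x; first by rewrite /Z /Y !big_nil.
  rewrite rewardS /Z sum_walks_ltS /= mulr0 add0r -big_split /=.
  apply: ler_sum => e _.
  rewrite (eq_bigr (fun w => p e x * (c e x *
      K w (q (endpoint dst (dst e) w)) (S e x) +
      K w (q (endpoint dst (dst e) w)) (S e x) * visits w c (S e x))));
    last by move=> w _; rewrite /endpoint /=; ring.
  rewrite -mulr_sumr big_split /= -mulr_sumr -/(Y m q (dst e) (S e x)).
  rewrite -/(Z m (dst e) (S e x)) -mulrDr; apply: ler_wpM2l => //.
  (* After the edge [e], the weights of all stopping continuations add up to at most 1, so the cost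
     of [e] is counted at most once. *)
  apply: lerD => //; rewrite ler_piMr// reward_stop_probability lerBlDr lerDl.
  exact: survival_ge0.
rewrite -sum_node_inflow_transition//; apply: le_trans (reward_le n bpsi psi0).
apply: le_trans (wint_le nr (bZ n s) (bm_reward _ _ bpsi) (ZY n s)).
rewrite wint_sum//; last first.
  move=> w _; apply: bmM; last exact: bm_visits.
  by apply: bm_follow; exact: bm_stop_probability.
apply: sum_st_walks_le => [w _ ->//|w]; apply: wint_ge0 => // x.
by rewrite mulr_ge0 ?visits_ge0 ?follow_ge0// => y; exact: stop_probability_ge0.
Qed.

(** Rearranged, this concerns [g] minus the flows of [W n]: its tested outflow exceeds its tested
    inflow by at most [B] times the mass alive after [n] steps. It is the sum of the four facts
    [tele], [stop], [flow] and [start]. *)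
Lemma walk_flow_balance n (phi : V -> T -> R) B :
  (forall v, bm (phi v)) -> (forall v x, 0 <= phi v x <= B) ->
  \sum_e J (g e) (phi (src e)) +
  \sum_(w <- W n) J r (fun x =>
    h w x * visits w (fun e y => phi (dst e) (S e y)) x) <=
  \sum_(w <- W n) J r (fun x => h w x * visits w (fun e => phi (src e)) x) +
  \sum_e J (g e) (fun x => phi (dst e) (S e x)) + B * J r (U n s).
Proof.
move=> bphi phiB.
have phi0 v x : 0 <= phi v x by have /andP[] := phiB v x.
have bS e : bm (fun y => phi (dst e) (S e y)) by exact: (bm_comp (mS e)).
have bh w v : bm (K w (q v)) by apply: bm_follow; exact: bm_stop_probability.
have bKphi w v : bm (K w (fun y => q v y * phi v y)).
  by apply: bm_follow; apply: bmM => //; exact: bm_stop_probability.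
have B0 : 0 <= B by have /andP[] := phiB s point; exact: le_trans.
have tele : \sum_(w <- W n) J r (fun x =>
      h w x * visits w (fun e => phi (src e)) x) +
    \sum_(w <- W n) J r (K w (fun y => q t y * phi t y)) =
    \sum_(w <- W n) J r (fun x => h w x * phi s x) +
    \sum_(w <- W n) J r (fun x =>
      h w x * visits w (fun e y => phi (dst e) (S e y)) x).
  rewrite -!big_split /= !big_seq; apply: eq_bigr => w.
  rewrite mem_filter mem_walks_lt => /andP[/eqP wt /andP[pw _]].
  rewrite -!wintD//; try by [apply: bmM => //; exact: bm_visits|exact: bmM].
  apply: eq_wint => x; rewrite -follow_mul -!mulrDr; congr (_ * _).
  by rewrite -visits_telescope// wt.
(* Apply [reward_le] to the reward that is collected only on stopping at [t]. *)
have stop : \sum_(w <- W n) J r (K w (fun y => q t y * phi t y)) <=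
    M t (fun y => q t y * phi t y).
  pose psi v y := if v == t then q t y * phi t y else 0.
  have bpsi v : bm (psi v).
    rewrite /psi; case: eqP => _; last exact: bm_cst.
    by apply: bmM => //; exact: bm_stop_probability.
  have psi0 v y : 0 <= psi v y.
    by rewrite /psi; case: eqP => _ //; rewrite mulr_ge0// stop_probability_ge0.
  apply: (@le_trans _ _ (J r (Y n psi s))).
    rewrite wint_sum//; last by move=> w _; exact: bm_follow.
    apply: sum_st_walks_le => [w _ wt|w]; first by rewrite /psi wt eqxx.
    by apply: wint_ge0 => // x; apply: follow_ge0.
  apply: le_trans (reward_le n bpsi psi0) _.
  rewrite (bigD1 t)//= big1 ?addr0 => [|v /negbTE vt]; last first.
    by rewrite /psi vt node_inflow0.
  by rewrite /psi eqxx.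
(* At each node the inflow splits into departing and stopping mass; the nonnegative stopping terms
   away from [t] are dropped. *)
have flow : \sum_e J (g e) (phi (src e)) + M t (fun y => q t y * phi t y) <=
    J r (phi s) + \sum_e J (g e) (fun x => phi (dst e) (S e x)).
  rewrite -sum_node_inflow -sum_node_inflow_transition// [leRHS](eq_bigr (fun v =>
      M v (fun x => \sum_(e | src e == v) p e x * phi (src e) x) +
      M v (fun x => q v x * phi v x))); last first.
    move=> v _; rewrite -node_inflowD//; last 2 first.
    - by apply: bm_sum => e _; exact: bmM.
    - by apply: bmM => //; exact: bm_stop_probability.
    congr M; apply/funext => x.
    rewrite (eq_bigr (fun e => p e x * phi v x)) => [|e /eqP -> //].
    by rewrite -mulr_suml -mulrDl /q addrC subrK mul1r.
  rewrite [leRHS]big_split /= lerD2l (bigD1 t)//= lerDl sumr_ge0// => v _.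
  by apply: node_inflow_ge0 => x; rewrite mulr_ge0// stop_probability_ge0.
(* Source mass either stops after fewer than [n] edges or survives, and the survivors are tested by
   at most [B]. Stopping away from [t] has expectation 0: [psi] is the reward for it, and [q_null]
   annihilates it under the inflows. *)
have start : J r (phi s) <= \sum_(w <- W n) J r (fun x => h w x * phi s x) +
    B * J r (U n s).
  pose psi v y := if v == t then 0 else q v y.
  have bpsi v : bm (psi v).
    by rewrite /psi; case: eqP => _; [exact: bm_cst|exact: bm_stop_probability].
  have psi0 v y : 0 <= psi v y.
    by rewrite /psi; case: eqP => _ //; exact: stop_probability_ge0.
  have Ypsi : J r (Y n psi s) <= 0.
    apply: le_trans (reward_le n bpsi psi0) _.
    rewrite big1// => v _; rewrite /psi.
    have [_|vt] := eqVneq v t; first exact: node_inflow0.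
    exact: q_null.
  have -> : J r (phi s) = J r (fun x => Y n q s x * phi s x) +
      J r (fun x => U n s x * phi s x).
    rewrite -wintD//; last 2 first.
    - by apply: bmM => //; apply: bm_reward => v; exact: bm_stop_probability.
    - by apply: bmM => //; exact: bm_survival.
    by apply: eq_wint => x; rewrite reward_stop_probability -mulrDl subrK mul1r.
  have UB : J r (fun x => U n s x * phi s x) <= B * J r (U n s).
    rewrite -wintZ//; last exact: bm_survival.
    apply: wint_le => //.
    - by apply: bmM => //; exact: bm_survival.
    - by apply: bmM; [exact: bm_cst|exact: bm_survival].
    move=> x; rewrite mulrC ler_wpM2r ?survival_ge0//.
    by have /andP[] := phiB s x.
  apply: lerD UB.
  have -> : J r (fun x => Y n q s x * phi s x) =
      \sum_(w <- walks_lt src dst n s)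
        J r (fun x => K w (q (endpoint dst s w)) x * phi s x).
    rewrite -wint_sum//; last by move=> w _; exact: bmM.
    by apply: eq_wint => x; rewrite -mulr_suml.
  have nonstop : \sum_(w <- walks_lt src dst n s)
      J r (fun x => K w (psi (endpoint dst s w)) x * phi s x) <= 0.
    apply: le_trans (mulr_ge0_le0 B0 Ypsi); rewrite [J r (Y _ _ _)]wint_sum//.
      rewrite mulr_sumr; apply: ler_sum => w _.
      rewrite -wintZ//; last exact: bm_follow.
      apply: wint_le => //.
      - by apply: bmM => //; exact: bm_follow.
      - by apply: bmM; [exact: bm_cst|exact: bm_follow].
      move=> x; rewrite mulrC ler_wpM2r ?follow_ge0//.
      by have /andP[] := phiB s x.
    by move=> w _; exact: bm_follow.
  rewrite -[leRHS]addr0; apply: le_trans (lerD (lexx _) nonstop).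
  rewrite big_filter [X in _ <= X + _]big_mkcond /= -big_split /=.
  apply: ler_sum => w _; rewrite /psi; case: eqP => [->|_].
    by rewrite lerDl; apply: wint_ge0 => // x; rewrite mulr_ge0// follow_ge0.
  by rewrite add0r.
lra.
Qed.

End MarkovChain.

(** * Decomposition up to a residual *)

Section Limit.
Context d (T : measurableType d) (R : realType).
Variable mu : {measure set T -> \bar R}.
Local Notation bm := bounded_measurable.
Local Notation nni := (nonneg_integrable mu).
Local Notation J := (wint mu).

Lemma wint_indic f A : nni f -> measurable A ->
  (J f \1_A)%:E = (\int[mu]_(x in A) (f x)%:E)%E.
Proof.
move=> nf mA; rewrite wintE//; last exact: bm_indic.
rewrite [RHS]integral_mkcond; apply: eq_integral => x _.
by rewrite /= epatch_indic -EFinM.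
Qed.

Lemma wint_le_ae f g : nni f -> nni g ->
  (forall A, measurable A -> J f \1_A <= J g \1_A) ->
  {ae mu, forall x, f x <= g x}.
Proof.
move=> nf ng fg; have [mf f0 fi] := nf; have [mg g0 gi] := ng.
pose B := [set x | g x < f x].
have mB : measurable B by rewrite -[B]setTI; apply: measurable_fun_ltr.
have : ae_eq mu B (EFin \o f) (EFin \o g).
  apply: integral_ae_eq => //.
  - by apply: integrableS fi.
  - by apply/measurable_funTS/measurable_EFinP.
  move=> A AB mA; rewrite -!wint_indic//; congr EFin; apply/eqP.
  rewrite eq_le fg//= -lee_fin !wint_indic//.
  apply: ge0_le_integral => //.
  - by move=> x _; rewrite lee_fin.
  - exact/measurable_funTS/measurable_EFinP.
  - exact/measurable_funTS/measurable_EFinP.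
  - by move=> x /AB /ltW; rewrite lee_fin.
apply: filterS => x h; rewrite leNgt; apply/negP => gf.
by have [] := h gf; move/eqP; rewrite gt_eqF.
Qed.

Lemma eq_ae_wint f g phi : nni f -> nni g -> bm phi ->
  {ae mu, forall x, f x = g x} -> J f phi = J g phi.
Proof.
move=> nf ng bphi fg; congr fine; apply: ae_eq_integral => //.
- by have := nni_int nf bphi; exact: measurable_int.
- by have := nni_int ng bphi; exact: measurable_int.
- by apply: filterS fg => x /= -> _.
Qed.

Lemma sum_uniq_le (I : eqType) (l1 l2 : seq I) (F : I -> R) :
  uniq l1 -> uniq l2 -> {subset l1 <= l2} -> (forall i, 0 <= F i) ->
  \sum_(i <- l1) F i <= \sum_(i <- l2) F i.
Proof.
move=> u1 u2 l12 F0.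
have /(perm_big _) -> : perm_eq l2 (l1 ++ [seq i <- l2 | i \notin l1]).
  apply: uniq_perm => //.
    rewrite cat_uniq u1 filter_uniq// andbT /=.
    by apply/hasPn => i; rewrite mem_filter => /andP[].
  move=> i; rewrite mem_cat mem_filter.
  by case: (boolP (i \in l1)) => [/l12|].
by rewrite big_cat /= lerDl sumr_ge0.
Qed.

Lemma wint_cvg (f : nat -> T -> R) fl g phi : (forall n, nni (f n)) -> nni fl ->
  nni g -> bm phi -> (forall x, f n x @[n --> \oo] --> fl x) ->
  (forall n x, f n x <= g x) ->
  J (f n) phi @[n --> \oo] --> J fl phi.
Proof.
move=> nf nfl ng bphi ffl fg.
have [mphi [B hB]] := bphi.
have iB : mu.-integrable setT (fun x => (g x * `|B|)%:E).
  exact: (nni_int ng (bm_cst `|B|)).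
have [|||||_ _ +] := @dominated_convergence _ _ _ mu setT measurableT
    (fun n x => (f n x * phi x)%:E) (fun x => (fl x * phi x)%:E)
    (fun x => (g x * `|B|)%:E).
- by move=> n; have := nni_int (nf n) bphi; exact: measurable_int.
- by have := nni_int nfl bphi; exact: measurable_int.
- apply: aeW => x _; apply: cvg_EFin; first exact: nearW.
  by apply: cvgMl; exact: ffl.
- exact: iB.
- apply: aeW => x n _; rewrite lee_fin normrM; apply: ler_pM => //.
    by rewrite ger0_norm; [exact: fg|case: (nf n)].
  by rewrite (le_trans (hB x))// ler_norm.
under eq_fun do rewrite -wintE//.
by rewrite -wintE// => /fine_cvg.
Qed.

Context {V E : finType} (src dst : E -> V) (s t : V) (S : E -> T -> T).
Variables (r : T -> R) (g : E -> T -> R).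
Hypotheses (mS : forall e, measurable_fun setT (S e)).
Hypotheses (nr : nni r) (ng : forall e, nni (g e)).
Local Notation M := (node_inflow mu dst s S r g).
Local Notation W n :=
  [seq w <- walks_lt src dst n s | endpoint dst s w == t].

Lemma mem_st_walks n w : (w \in W n) =
  [&& endpoint dst s w == t, walk_from src dst s w & (size w < n)%N].
Proof. by rewrite mem_filter mem_walks_lt. Qed.

Lemma uniq_st_walks n : uniq (W n).
Proof. by rewrite filter_uniq// uniq_walks_lt. Qed.

(** The final inequality is the limit of [walk_flow_balance]. For the convergence of the walk flows
    it is enough to record total masses: the differences are nonnegative, so masses are L^1
    norms. *)
Lemma walk_decomposition :
  (forall v A, measurable A ->
     \sum_(e | src e == v) J (g e) \1_A <= M v \1_A) ->
  (forall v, v != t ->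
     \sum_(e | src e == v) J (g e) (fun=> 1) = M v (fun=> 1)) ->
  exists (h : seq E -> T -> R) (l : seq E -> E -> T -> R) (k : E -> T -> R),
  [/\ forall w, nni (h w),
      forall w, walk_from src dst s w -> endpoint dst s w = t ->
        forall e, nni (l w e) /\ forall phi, bm phi ->
          \sum_(j < size w | nth e w j == e)
            J (h w) (fun x => phi (arrive S (take j w) x)) = J (l w e) phi,
      forall e, [/\ nni (k e),
        forall n, {ae mu, forall x, \sum_(w <- W n) l w e x + k e x <= g e x} &
        J (g e) (fun=> 1) - \sum_(w <- W n) J (l w e) (fun=> 1) @[n --> \oo]
          --> J (k e) (fun=> 1)] &
      forall phi : V -> T -> R, (forall v, bm (phi v)) ->
        (forall v x, 0 <= phi v x) ->
        \sum_e J (k e) (phi (src e)) <=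
        \sum_e J (k e) (fun x => phi (dst e) (S e x))].
Proof.
move=> bal_le bal_eq.
have [p [bp p0 p1 pE]] := transition_probabilities mS nr ng bal_le.
pose q := stop_probability src p.
(* Away from [t] the total inflow leaves again, so the stopping probability integrates to 0 against
   the inflow. *)
have q_null v : v != t -> M v (q v) = 0.
  move=> vt; have h1 : \sum_(e | src e == v) M v (p e) = M v (fun=> 1).
    rewrite -bal_eq//; apply: eq_bigr => e /eqP <-; rewrite pE; last exact: bm_cst.
    by congr M; apply/funext => x; rewrite mulr1.
  have : M v (fun=> 1) = M v (q v) + \sum_(e | src e == v) M v (p e).
    rewrite -node_inflow_sum// -node_inflowD//;
      [|exact: bm_stop_probability|exact: bm_sum].
    by congr M; apply/funext => x; rewrite subrK.
  by rewrite h1; lra.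
have bh w : bm (follow S p w (q t)).
  by apply: bm_follow => //; exact: bm_stop_probability.
have h0 w x : 0 <= follow S p w (q t) x.
  by apply: follow_ge0 => // y; exact: stop_probability_ge0.
pose h w x := r x * follow S p w (q t) x.
have nh w : nni (h w).
  split; last exact: nni_int.
  - by apply: measurable_funM; [case: nr|case: (bh w)].
  - by move=> x; rewrite mulr_ge0//; case: nr.
have hE w phi : J (h w) phi = J r (fun x => follow S p w (q t) x * phi x).
  exact: wint_mul.
pose is_st w := walk_from src dst s w && (endpoint dst s w == t).
have is_stW w : is_st w -> w \in W (size w).+1.
  by rewrite mem_st_walks ltnS leqnn andbT andbC.
have ex_l (we : seq E * E) : exists l, is_st we.1 -> nni l /\
    forall phi, bm phi -> \sum_(j < size we.1 | nth we.2 we.1 j == we.2)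
      J (h we.1) (fun x => phi (arrive S (take j we.1) x)) = J l phi.
  case: we => w e /=; case: (boolP (is_st w)) => [st|_]; last by exists (fun=> 0).
  (* A walk may use [e] several times. Each passage gets its own density, being dominated by [g e],
     and the densities are added afterwards. *)
  have piece (j : 'I_(size w)) : exists l, nth e w j == e -> nni l /\
      forall phi, bm phi ->
        J (h w) (fun x => phi (arrive S (take j w) x)) = J l phi.
    case: eqP => [je|_]; last by exists (fun=> 0).
    have [|l nl lE] := density_pushforward (nh w) (ng e)
      (measurable_arrive mS (take j w)); last by exists l.
    move=> A mA; rewrite hE.
    (* This cost counts the entries into [e] during [A]; along [w] it is at least the single
       contribution of position [j]. *)
    pose c e' x := if e' == e then \1_A x else 0 : R.
    have bc e' : bm (c e').
      by rewrite /c; case: eqP => _; [exact: bm_indic|exact: bm_cst].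
    have c0 e' x : 0 <= c e' x by rewrite /c; case: eqP.
    have ce : c e = \1_A by apply/funext => x; rewrite /c eqxx.
    have := walk_flow_le t mS nr ng bp p0 p1 pE (size w).+1 bc c0.
    rewrite [leRHS](bigD1 e)//= [X in _ + X]big1 ?addr0; last first.
      by move=> e' /negbTE e'e; rewrite /c e'e wint0.
    rewrite ce; apply: le_trans.
    rewrite (bigD1_seq w (is_stW _ st) (uniq_st_walks _)) /=.
    apply: (@le_trans _ _ (J r (fun x => follow S p w (q t) x *
        visits S w c x))); last first.
      rewrite lerDl; apply: sumr_ge0 => w' _; apply: wint_ge0 => // x.
      by rewrite mulr_ge0// visits_ge0.
    apply: wint_le => //.
    - apply: bmM => //; apply: (bm_comp (measurable_arrive mS _)).
      exact: bm_indic.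
    - by apply: bmM => //; exact: bm_visits.
    - move=> x; apply: ler_wpM2l => //; rewrite (visitsE _ _ _ _ e).
      rewrite (bigD1 j)//= je ce lerDl sumr_ge0//.
  have /choice[l hl] := piece.
  exists (fun x => \sum_(j < size w | nth e w j == e) l j x) => _.
  pose l' (j : 'I_(size w)) := if nth e w j == e then l j else fun=> 0.
  have nl' j : nni (l' j).
    by rewrite /l'; case: ifP => [/hl[]//|_]; exact: nni0.
  have -> : (fun x => \sum_(j < size w | nth e w j == e) l j x) =
      (fun x => \sum_(j < size w | nth e w j == e) l' j x).
    by apply/funext => x; apply: eq_bigr => j je; rewrite /l' je.
  split; first exact: nni_sum.
  move=> phi bphi; rewrite wint_suml//; apply: eq_bigr => j je.
  by rewrite /l' je; have [_ ->] := hl j je.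
have /choice[l' hl'] := ex_l.
pose l w e := if is_st w then l' (w, e) else fun=> 0.
have nl w e : nni (l w e).
  by rewrite /l; case: ifP => [/(hl' (w, e))[]|_] //; exact: nni0.
have lE w e phi : is_st w -> bm phi ->
    \sum_(j < size w | nth e w j == e)
      J (h w) (fun x => phi (arrive S (take j w) x)) = J (l w e) phi.
  by move=> st; rewrite /l st; have [_] := hl' (w, e) st; apply.
have l0 w e x : 0 <= l w e x by case: (nl w e).
have g0 e x : 0 <= g e x by case: (ng e).
have W_st n w : w \in W n -> is_st w.
  by rewrite mem_st_walks /is_st andbA => /andP[/andP[-> ->]].
have visits_l w c : is_st w -> (forall e, bm (c e)) ->
    J r (fun x => follow S p w (q t) x * visits S w c x) =
    \sum_e J (l w e) (c e).
  move=> st bc; rewrite -hE.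
  under [RHS]eq_bigr do rewrite -lE//.
  have := st; case: w st => [|e0 w'].
    move=> st _; rewrite wint0 big1// => e _; rewrite big_ord0//.
  set w := e0 :: w' => st _.
  transitivity (\sum_(j < size w)
      J (h w) (fun x => c (nth e0 w j) (arrive S (take j w) x))).
    rewrite -wint_sum//; last first.
      by move=> j _; apply: (bm_comp (measurable_arrive mS _)).
    by apply: eq_wint => x; rewrite (visitsE _ _ _ _ e0).
  rewrite (exchange_big_dep xpredT)//=; apply: eq_bigr => j _.
  rewrite (eq_bigl (pred1 (nth e0 w j))) ?big_pred1_eq// => e.
  by rewrite eq_sym (set_nth_default e0).
pose lam n e x := \sum_(w <- W n) l w e x.
have nlam n e : nni (lam n e).
  split.
  - by apply: measurable_sum => w; case: (nl w e).
  - by move=> x; exact: sumr_ge0.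
  - rewrite (_ : EFin \o _ = fun x => (\sum_(w <- W n) (l w e x)%:E)%E).
      by apply: integrable_sum => // w _; case: (nl w e).
    by apply/funext => x /=; rewrite sumEFin.
have lamE n e phi : bm phi -> J (lam n e) phi = \sum_(w <- W n) J (l w e) phi.
  move=> bphi; apply: EFin_inj; rewrite wintE// -sumEFin.
  under [RHS]eq_bigr do rewrite wintE//.
  rewrite -integral_sum//; last by move=> w; exact: nni_int.
  by apply: eq_integral => x _; rewrite sumEFin mulr_suml.
have lam_nd n e x : lam n e x <= lam n.+1 e x.
  apply: sum_uniq_le => //; try exact: uniq_st_walks.
  by move=> w; rewrite !mem_st_walks => /and3P[-> -> /= h1]; rewrite ltnS ltnW.
have lam_le n e : {ae mu, forall x, lam n e x <= g e x}.
  apply: wint_le_ae => // A mA; rewrite lamE//; last exact: bm_indic.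
  pose c e' x := if e' == e then \1_A x else 0 : R.
  have bc e' : bm (c e').
    by rewrite /c; case: eqP => _; [exact: bm_indic|exact: bm_cst].
  have c0 e' x : 0 <= c e' x by rewrite /c; case: eqP.
  have ce : c e = \1_A by apply/funext => x; rewrite /c eqxx.
  have := walk_flow_le t mS nr ng bp p0 p1 pE n bc c0.
  rewrite [leRHS](bigD1 e)//= [X in _ + X]big1 ?addr0; last first.
    by move=> e' /negbTE e'e; rewrite /c e'e wint0.
  rewrite ce; apply: le_trans; rewrite big_seq [leRHS]big_seq.
  apply: ler_sum => w /W_st st; rewrite visits_l// (bigD1 e)//= ce.
  by rewrite lerDl sumr_ge0// => e' _; exact: wint_ge0.
(* Truncation at 0 changes the difference only on a null set, but makes the sequence nonnegative and
   nonincreasing at every point, so its limit exists without exceptional set. *)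
pose kn n e x := Num.max 0 (g e x - lam n e x).
have kn_ge0 n e x : 0 <= kn n e x by rewrite le_max lexx.
have kn_le n e x : kn n e x <= g e x.
  by rewrite ge_max g0 lerBlDr lerDl sumr_ge0.
have mkn n e : measurable_fun setT (kn n e).
  apply: measurable_maxr => //; apply: measurable_funB; first by case: (ng e).
  by case: (nlam n e).
have nni_le (f : T -> R) e : measurable_fun setT f -> (forall x, 0 <= f x) ->
    (forall x, f x <= g e x) -> nni f.
  move=> mf f0 fg; split => //; have [_ _ gi] := ng e.
  apply: (le_integrable measurableT _ _ gi); first exact/measurable_EFinP.
  by move=> x _ /=; rewrite lee_fin !ger0_norm.
have nkn n e : nni (kn n e) by exact: (nni_le _ e).
have kn_ni n e x : kn n.+1 e x <= kn n e x.
  by rewrite ge_max !le_max lexx /= lerB ?orbT.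
have kn_nis e x : nonincreasing_seq (fun n => kn n e x).
  by apply/nonincreasing_seqP => n; exact: kn_ni.
have kn_lb e x : has_lbound (range (fun n => kn n e x)).
  by exists 0 => _ [n _ <-].
pose k e x := limn (fun n => kn n e x).
have kn_cvgn e x : cvgn (fun n => kn n e x).
  exact: nonincreasing_is_cvgn.
have kn_cvg e x : kn n e x @[n --> \oo] --> k e x by exact: kn_cvgn.
have k_ge0 e x : 0 <= k e x.
  by apply: limr_ge => //; exact: nearW.
have k_le n e x : k e x <= kn n e x.
  exact: (nonincreasing_cvgn_ge (kn_nis e x) (kn_cvgn e x) n).
have nk e : nni (k e).
  apply: (nni_le _ e) => //; last by move=> x; apply: le_trans (kn_le 0%N e x).
  by apply: (measurable_fun_cvg (h := fun n => kn n e)).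
have knE n e phi : bm phi -> J (kn n e) phi = J (g e) phi - J (lam n e) phi.
  move=> bphi.
  have : J (g e) phi = J (fun x => kn n e x + lam n e x) phi.
    apply: eq_ae_wint => //.
      have := @nni_sum _ T R mu _ xpredT
        (fun b : bool => if b then kn n e else lam n e).
      rewrite (_ : (fun x => _) = fun x => kn n e x + lam n e x); last first.
        by apply/funext => x; rewrite big_bool.
      by apply; case.
    by apply: filterS (lam_le n e) => x xle; rewrite /kn max_r ?subr_ge0// subrK.
  move=> ->; apply/eqP; rewrite eq_sym subr_eq; apply/eqP; apply: EFin_inj.
  have := @wint_suml _ T R mu _ xpredT
        (fun b : bool => if b then kn n e else lam n e) phi.
  rewrite (_ : (fun x => _) = fun x => kn n e x + lam n e x); last first.
    by apply/funext => x; rewrite big_bool.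
  by rewrite big_bool => -> //; case.
have Jkn e phi : bm phi -> J (kn n e) phi @[n --> \oo] --> J (k e) phi.
  by move=> bphi; apply: (@wint_cvg _ _ (g e)).
exists h, l, k; split => //.
- by move=> w pw wt e; split => // phi; apply: lE; rewrite /is_st pw wt eqxx.
- move=> e; split => //.
    move=> n; apply: filterS (lam_le n e) => x h1.
    have := k_le n e x; rewrite /kn max_r ?subr_ge0// => h2.
    by rewrite addrC -lerBrDr.
  have b1 : bm (fun _ : T => 1 : R) by exact: bm_cst.
  rewrite (_ : (fun n => _) = (fun n => J (kn n e) (fun=> 1))); first exact: Jkn.
  by apply/funext => n; rewrite knE// lamE.
move=> phi bphi phi0.
have /choice[B hB] v : exists B, forall x, phi v x <= B.
  have [_ [B hB]] := bphi v; exists B => x.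
  exact: le_trans (ler_norm _) (hB x).
pose BB := \sum_v `|B v|.
have phiB v x : 0 <= phi v x <= BB.
  rewrite phi0 /= (le_trans (hB v x))// (le_trans (ler_norm _))//.
  by rewrite /BB (bigD1 v)//= lerDl sumr_ge0.
have bS e : bm (fun y => phi (dst e) (S e y)) by exact: (bm_comp (mS e)).
(* [harmonic n] is 1/(n+1): [survival_le] supplies the factor n, and the second summand of [C], the
   survival at step 0, pays for the remaining 1. *)
pose C := \sum_v M v (fun=> 1) + J r (survival src dst S p 0 s).
have Uh n : J r (survival src dst S p n s) <= C * harmonic n.
  rewrite /harmonic /= ler_pdivlMr// mulrC -natr1 mulrDl mul1r lerD//.
    exact: survival_le.
  apply: wint_le => //; try exact: bm_survival.
  by move=> x; elim: n => [//|n]; apply: le_trans; exact: survival_leS.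
have key n : \sum_e J (kn n e) (phi (src e)) <=
    \sum_e J (kn n e) (fun x => phi (dst e) (S e x)) + BB * (C * harmonic n).
  have := walk_flow_balance mS nr ng bp p0 p1 pE q_null n bphi phiB.
  have lamW c : (forall e, bm (c e)) ->
      \sum_(w <- W n) J r (fun x => follow S p w (q t) x * visits S w c x) =
      \sum_e J (lam n e) (c e).
    move=> bc; under [RHS]eq_bigr do rewrite lamE//.
    rewrite exchange_big /= !big_seq; apply: eq_bigr => w /W_st st.
    by rewrite visits_l.
  rewrite !lamW//.
  have BB0 : 0 <= BB by exact: sumr_ge0.
  have := ler_wpM2l BB0 (Uh n).
  under [X in _ -> _ -> X <= _]eq_bigr do rewrite knE//.
  under [X in _ -> _ -> _ <= X + _]eq_bigr do rewrite knE//.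
  rewrite !sumrB; lra.
have cvg_sum c : (forall e, bm (c e)) ->
    \sum_e J (kn n e) (c e) @[n --> \oo] --> \sum_e J (k e) (c e).
  by move=> bc; apply: cvg_big => [|e _]; [exact: add_continuous|exact: Jkn].
have lhs := cvg_sum _ (fun e => bphi (src e)).
have rhs : \sum_e J (kn n e) (fun x => phi (dst e) (S e x)) +
    BB * (C * harmonic n) @[n --> \oo] -->
    \sum_e J (k e) (fun x => phi (dst e) (S e x)) + BB * (C * 0).
  apply: cvgD; first exact: (cvg_sum _ bS).
  by do 2 apply: cvgMr; exact: cvg_harmonic.
rewrite !mulr0 addr0 in rhs.
by apply: ler_cvg_to lhs rhs _; exact: nearW.
Qed.

End Limit.

(** * Decomposition of circulations into simple cycles *)

Section Cycles.
Context {V E : finType} (src dst : E -> V) (R : realType).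

Lemma walk_from_nodes v w : walk_from src dst v w ->
  v :: map dst w = rcons (map src w) (endpoint dst v w).
Proof.
elim: w v => [//|e w IHw] v /= /andP[/eqP <- pw].
by rewrite (IHw _ pw).
Qed.

Lemma simple_cycle_uniq c : simple_cycle src dst c -> uniq c.
Proof. by move=> /andP[_]; exact: map_uniq. Qed.

(** The tails of a closed walk are a permutation of its heads; since edges do not repeat, membership
    counts each of them once. *)
Lemma simple_cycle_balance c v (a : R) : simple_cycle src dst c ->
  \sum_(e | src e == v) (if e \in c then a else 0) =
  \sum_(e | dst e == v) (if e \in c then a else 0).
Proof.
move=> sc; have uc := simple_cycle_uniq sc.
have /andP[/existsP[v0]] := sc.
rewrite walk_walk_from => /and3P[_ /walk_from_nodes nodes /eqP cv0] _.
rewrite cv0 in nodes.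
have pc : perm_eq (map src c) (map dst c).
  by rewrite -(perm_cons v0) nodes perm_sym perm_rcons.
have sumE (f : E -> V) : \sum_(e | f e == v) (if e \in c then a else 0) =
    \sum_(u <- map f c | u == v) a.
  rewrite big_map -big_mkcondr /= [RHS]big_mkcond big_uniq//= -big_mkcondr /=.
  by apply: eq_bigl => e; rewrite andbC.
by rewrite !sumE (perm_big _ pc).
Qed.

(** By balance the head of a positive edge has a positive edge leaving it. Iterating one choice of
    such edges on finitely many nodes must return to an earlier node. *)
Lemma circulation_has_cycle (y : E -> R) e0 :
  (forall e, 0 <= y e) ->
  (forall v, \sum_(e | src e == v) y e = \sum_(e | dst e == v) y e) ->
  0 < y e0 ->
  exists2 c, simple_cycle src dst c & forall e, e \in c -> 0 < y e.
Proof.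
move=> y0 bal ye0.
pose active v := [exists e, (src e == v) && (0 < y e)].
pose a v := odflt e0 [pick e | (src e == v) && (0 < y e)].
pose f v := dst (a v).
have aP v : active v -> src (a v) = v /\ 0 < y (a v).
  rewrite /a; case: pickP => [e /andP[/eqP <-]//|none /existsP[e]].
  by rewrite none.
have active_f v : active v -> active (f v).
  move=> /aP[_ yav]; apply: contraT => /existsPn noe.
  have /eqP := bal (f v); rewrite big1 => [|e ve]; last first.
    by apply/eqP; rewrite eq_le y0 andbT leNgt; have := noe e; rewrite ve.
  rewrite eq_sym psumr_eq0// => /allP /(_ (a v)).
  by rewrite mem_index_enum eqxx gt_eqF// => /(_ isT).
pose x0 := src e0.
have active_x0 : active x0 by apply/existsP; exists e0; rewrite eqxx.
have active_iter n : active (iter n f x0).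
  by elim: n => [//|n IHn] /=; exact: active_f.
have cycleP n v : active v ->
    [/\ map src (map a (traject f v n)) = traject f v n,
        walk_from src dst v (map a (traject f v n)),
        endpoint dst v (map a (traject f v n)) = iter n f v &
        forall e, e \in map a (traject f v n) -> 0 < y e].
  elim: n v => [//|n IHn] v av.
  have [s1 s2 s3 s4] := IHn _ (active_f _ av); have [sa ya] := aP _ av.
  rewrite trajectS; split.
  - by rewrite /= s1 sa.
  - by rewrite /= sa eqxx.
  - by rewrite iterSr -s3.
  - by move=> e; rewrite inE => /predU1P[-> //|]; exact: s4.
(* The orbit of [x0] consists of [order f x0] distinct nodes and then returns to the one with index
   [i]. The cycle is its tail from there, of length [n], and distinctness makes it simple. *)
have /trajectP[i lti xi] := looping_order f x0.
pose x := iter i f x0; pose n := (order f x0 - i)%N.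
have [c1 c2 c3 c4] := cycleP n x (active_iter i).
exists (map a (traject f x n)) => //; apply/andP; split.
  apply/existsP; exists x; rewrite walk_walk_from c2 c3 /x -iterD subnK 1?ltnW//.
  by rewrite xi eqxx /n -(prednK (n := order f x0 - i)) ?subn_gt0.
rewrite c1; have := orbit_uniq f x0; rewrite /orbit -(subnKC (ltnW lti)).
by rewrite trajectD cat_uniq => /and3P[].
Qed.

Lemma minimum_measurable d (T : measurableType d) (y : E -> T -> R) (c : seq E) :
  (forall e, measurable_fun setT (y e)) -> c != [::] ->
  exists m : T -> R, [/\ measurable_fun setT m,
    forall e x, e \in c -> m x <= y e x &
    forall x, exists2 e, e \in c & m x = y e x].
Proof.
move=> my; elim: c => [//|e c IHc] _.
have [->|cn] := eqVneq c [::].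
  exists (y e); split => // [e' x|x]; first by rewrite inE => /eqP ->.
  by exists e => //; rewrite inE.
have [m [mm mle mex]] := IHc cn.
exists (fun x => Num.min (y e x) (m x)); split.
- exact: measurable_minr.
- move=> e' x; rewrite inE => /predU1P[->|e'c]; rewrite ge_min ?lexx//.
  by rewrite mle// orbT.
- move=> x; case: (leP (y e x) (m x)) => _.
    by exists e => //; rewrite mem_head.
  by have [e' e'c ->] := mex x; exists e' => //; rewrite inE e'c orbT.
Qed.

(** Subtracting from each cycle the pointwise minimum over its edges exhausts one of them at every
    [x]. An exhausted edge stays exhausted, as remainders decrease and remain nonnegative, so one
    pass in a fixed order suffices and measurability is kept. *)
Lemma cycle_peeling d (T : measurableType d) (cs : seq (seq E))
    (y : E -> T -> R) :
  uniq cs -> (forall c, c \in cs -> c != [::]) ->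
  (forall e, measurable_fun setT (y e)) -> (forall e x, 0 <= y e x) ->
  exists h : seq E -> T -> R,
  [/\ forall c, measurable_fun setT (h c), forall c x, 0 <= h c x,
      forall e x, \sum_(c <- cs) (if e \in c then h c x else 0) <= y e x &
      forall c x, c \in cs -> exists2 e, e \in c &
        \sum_(c <- cs) (if e \in c then h c x else 0) = y e x].
Proof.
elim: cs y => [|c cs IHcs] y /=.
  move=> _ _ my y0; exists (fun _ _ => 0); split => //.
  by move=> e x; rewrite big_nil.
move=> /andP[ccs ucs] csn my y0.
have [m [mm mle mex]] := minimum_measurable my (csn _ (mem_head _ _)).
have m0 x : 0 <= m x by have [e _ ->] := mex x.
pose y1 e x := y e x - (if e \in c then m x else 0).
have y1_ge0 e x : 0 <= y1 e x.
  by rewrite subr_ge0; case: ifP => // ec; exact: mle.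
have my1 e : measurable_fun setT (y1 e).
  by apply: measurable_funB => //; case: (e \in c).
have [|h [mh h0 hle hex]] := IHcs y1 ucs _ my1 y1_ge0.
  by move=> c' c'cs; apply: csn; rewrite inE c'cs orbT.
pose h' c' := if c' == c then m else h c'.
have sumE e x : \sum_(c' <- c :: cs) (if e \in c' then h' c' x else 0) =
    (if e \in c then m x else 0) + \sum_(c' <- cs) (if e \in c' then h c' x else 0).
  rewrite big_cons {1}/h' eqxx; congr (_ + _).
  rewrite !big_seq; apply: eq_bigr => c' c'cs; rewrite /h'.
  by case: (c' =P c) => // c'c; rewrite -c'c c'cs in ccs.
exists h'; split.
- by move=> c'; rewrite /h'; case: ifP.
- by move=> c' x; rewrite /h'; case: ifP.
- by move=> e x; rewrite sumE addrC -lerBrDr; exact: hle.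
- move=> c' x; rewrite inE => /predU1P[->|c'cs].
    (* At an edge that attains the minimum the remainder is 0, so the later cycles can take nothing
       from it. *)
    have [e ec me] := mex x; exists e => //; rewrite sumE ec me.
    have := hle e x; rewrite /y1 ec me subrr => hle0.
    have : 0 <= \sum_(c'0 <- cs) (if e \in c'0 then h c'0 x else 0).
      by apply: sumr_ge0 => c'' _; case: ifP.
    by move=> hge0; rewrite (_ : \sum_(_ <- _) _ = 0) ?addr0//; apply/le_anti/andP.
  have [e ec' he] := hex c' x c'cs; exists e => //.
  by rewrite sumE he /y1 addrC subrK.
Qed.

(** At a balanced [x] the remainder after one pass is a circulation; if positive, it would contain a
    simple cycle of positive edges, although every simple cycle has an exhausted edge. The bound by
    [y] will pass integrability and absence of delay on to the cycle rates. *)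
Lemma circulation_decomposition d (T : measurableType d) (y : E -> T -> R) :
  (forall e, measurable_fun setT (y e)) -> (forall e x, 0 <= y e x) ->
  exists h : seq E -> T -> R,
  [/\ forall c, measurable_fun setT (h c), forall c x, 0 <= h c x,
      forall c e x, simple_cycle src dst c -> e \in c -> h c x <= y e x &
      forall x,
        (forall v, \sum_(e | src e == v) y e x = \sum_(e | dst e == v) y e x) ->
        forall e, y e x = \sum_(c \in [set c | simple_cycle src dst c])
          (if e \in c then h c x else 0)].
Proof.
move=> my y0.
pose A := [set c | simple_cycle src dst c].
have finA : finite_set A by exact: finite_simple_cycle.
pose cs : seq (seq E) := fset_set A.
have csE c : (c \in cs) = simple_cycle src dst c.
  rewrite /cs in_fset_set//; apply/idP/idP; first by rewrite inE.
  by move=> h; rewrite inE.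
have ucs : uniq cs by exact: fset_uniq.
have csn c : c \in cs -> c != [::].
  rewrite csE => /andP[/existsP[v]].
  by rewrite walk_walk_from => /and3P[].
have [h [mh h0 hle hex]] := cycle_peeling ucs csn my y0.
exists h; split => //.
  move=> c e x sc ec; apply: le_trans (hle e x).
  rewrite (bigD1_seq c)/= ?csE// ec lerDl.
  by apply: sumr_ge0 => c' _; case: ifP.
move=> x bal e; rewrite fsbig_finite//= -/cs.
pose z e := y e x - \sum_(c <- cs) (if e \in c then h c x else 0).
have z0 e' : 0 <= z e' by rewrite subr_ge0.
suff : z e = 0 by move/eqP; rewrite subr_eq0 => /eqP.
apply/eqP; rewrite eq_le z0 andbT leNgt; apply/negP => ze.
have zbal v : \sum_(e | src e == v) z e = \sum_(e | dst e == v) z e.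
  rewrite !sumrB bal; congr (_ - _).
  rewrite exchange_big [RHS]exchange_big /= !big_seq; apply: eq_bigr => c.
  by rewrite csE; exact: simple_cycle_balance.
have [c sc cpos] := circulation_has_cycle z0 zbal ze.
have [|e' e'c he'] := hex c x; first by rewrite csE.
by have := cpos e' e'c; rewrite /z he' subrr ltxx.
Qed.

End Cycles.

(** * Flows on the time horizon *)

Section Horizon.
Context {R : realType}.
Local Notation sigma := (@lebesgue_measure R).
Local Notation bm := bounded_measurable.
Local Notation nni := (nonneg_integrable sigma).
Local Notation J := (wint sigma).

Lemma Rintegral_ae_eq (A : set R) (f G : R -> R) : measurable A ->
  measurable_fun A f -> measurable_fun setT G ->
  {ae sigma, forall x, (f \_ A) x = G x} ->
  \int[sigma]_(x in A) f x = \int[sigma]_x G x.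
Proof.
move=> mA mf mG fG; rewrite Rintegral_mkcond; congr fine.
apply: ae_eq_integral => //.
- apply/measurable_EFinP; apply/(measurable_restrict _ mA measurableT).
  by rewrite setTI.
- exact/measurable_EFinP.
- by apply: ae_impl fG => x /= -> _.
Qed.

Lemma wint_le0_ae f phi : nni f -> bm phi -> (forall x, 0 <= phi x) ->
  J f phi <= 0 -> {ae sigma, forall x, f x * phi x = 0}.
Proof.
move=> nf bphi phi0 Jle; have [mf f0 fi] := nf.
have nfphi : nni (fun x => f x * phi x).
  split; last exact: nni_int.
  - by apply: measurable_funM => //; case: bphi.
  - by move=> x; rewrite mulr_ge0.
have : {ae sigma, forall x, f x * phi x <= 0}.
  apply: (wint_le_ae nfphi (nni0 sigma)) => A mA.
  have -> : J (fun=> 0) \1_A = 0.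
    rewrite /J /Rintegral (_ : (fun x => _) = cst 0%E) ?integral0//.
    by apply/funext => x; rewrite mul0r.
  rewrite wint_mul; apply: le_trans Jle; apply: wint_le => //.
    by apply: bmM => //; exact: bm_indic.
  by move=> x; rewrite indicE; case: (_ \in _); rewrite ?mulr1// mulr0.
by apply: ae_impl => x h; apply/le_anti; rewrite h mulr_ge0.
Qed.

Variable tf : R.
Local Notation H := (horizon tf).

Lemma measurable_horizon : measurable H.
Proof. exact: measurable_itv. Qed.

(** A representative of an element of L_+(H) that is nonnegative everywhere and vanishes off H, as
    [nonneg_integrable] and integration over the whole line require. *)
Definition pos_part_on (f : R -> R) : R -> R := (fun x => Num.max (f x) 0) \_ H.

Lemma pos_part_on_ge0 f x : 0 <= pos_part_on f x.
Proof.
by rewrite /pos_part_on patchE; case: ifP => // _; rewrite le_max lexx orbT.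
Qed.

Lemma pos_part_on_notin f x : ~ H x -> pos_part_on f x = 0.
Proof. by move=> nHx; rewrite /pos_part_on patchE memNset. Qed.

Lemma measurable_inL f : inL tf f -> measurable_fun H f.
Proof. by move=> /measurable_int /measurable_EFinP. Qed.

Lemma nni_pos_part_on f : inL tf f -> nni (pos_part_on f).
Proof.
move=> fL; have mf := measurable_inL fL.
have mcl : measurable_fun setT (pos_part_on f).
  apply/(measurable_restrict _ measurable_horizon measurableT).
  by rewrite setTI; apply: measurable_maxr.
split => //; first exact: pos_part_on_ge0.
have mH : measurable (H : set (measurableTypeR R)) by exact: measurable_horizon.
have fi := (@integrable_mkcond _ _ _ sigma _ (EFin \o f) mH).1 fL.
apply: (le_integrable measurableT _ _ fi); first exact/measurable_EFinP.
move=> x _; have [Hx|nHx] := pselect (H x); last first.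
  by rewrite /= pos_part_on_notin// normr0 abse_ge0.
rewrite /= /pos_part_on !patchE mem_set//= lee_fin ger0_norm ?le_max ?lexx ?orbT//.
by rewrite ge_max ler_norm normr_ge0.
Qed.

Lemma pos_part_on_ae f : inLplus tf f ->
  {ae sigma, forall x, H x -> pos_part_on f x = f x}.
Proof.
move=> [_]; apply: ae_impl => x f0 Hx.
by rewrite /pos_part_on patchE mem_set// max_l// f0.
Qed.

Lemma wint_pos_part_on f (B : set R) psi :
  inLplus tf f -> measurable B -> B `<=` H -> bm psi -> (forall x, H x -> psi x = \1_B x) ->
  J (pos_part_on f) psi = \int[sigma]_(x in B) f x.
Proof.
move=> fL mB BH bpsi psiB; symmetry; apply: Rintegral_ae_eq => //.
- by apply: measurable_funS (measurable_inL fL.1) => //; exact: measurable_horizon.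
- by apply: measurable_funM; [case: (nni_pos_part_on fL.1)|case: bpsi].
apply: ae_impl (pos_part_on_ae fL) => x fE; rewrite patchE.
have [Hx|nHx] := pselect (H x); last first.
  rewrite pos_part_on_notin// mul0r; case: ifP => //; rewrite inE => Bx.
  by exfalso; apply: nHx; exact: BH.
rewrite fE// psiB// indicE; case: (x \in B); last by rewrite mulr0.
by rewrite mulr1.
Qed.

Lemma inLplus_nni f : nni f -> inLplus tf f.
Proof.
move=> [mf f0 fi]; split; last by apply: aeW.
by apply: integrableS fi => //; exact: measurable_horizon.
Qed.

Context {V E : finType} (src dst : E -> V) (s t : V).
Context (D : E -> (E -> R -> R) -> R -> R) (u : E -> R -> R).
Hypothesis T_nondecreasing : forall e,
  nondecreasing_on H (exit_time D u e).
Hypothesis A_horizon : forall (w : seq E) (j : nat) x,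
  is_walk src dst w -> (j <= size w)%N -> H x -> H (arrival D u w j x).

(* Exit times are only controlled on H; extended by the identity they are
   monotone, hence measurable, on the whole line. *)
Definition full_exit_time (e : E) (x : R) : R :=
  if x \in H then exit_time D u e x else x.
Local Notation T := full_exit_time.

Lemma exit_in e x : H x -> H (exit_time D u e x).
Proof.
move=> Hx; have := @A_horizon [:: e] 1 x; rewrite /arrival /=; apply => //.
by apply/existsP; exists (src e); apply/existsP; exists (dst e); rewrite /= !eqxx.
Qed.

Lemma full_exit_timeE e x : H x -> T e x = exit_time D u e x.
Proof. by move=> Hx; rewrite /T mem_set. Qed.

Lemma full_exit_time_out e x : ~ H x -> T e x = x.
Proof. by move=> nHx; rewrite /T memNset. Qed.

Lemma full_exit_time_in e x : H (T e x) <-> H x.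
Proof.
split=> [|Hx]; last by rewrite full_exit_timeE//; exact: exit_in.
by have [//|nHx] := pselect (H x); rewrite full_exit_time_out.
Qed.

(** Since H is an interval mapped into itself, gluing with the identity outside keeps the function
    monotone across both end points. *)
Lemma measurable_full_exit_time e : measurable_fun setT (T e).
Proof.
apply: nondecreasing_measurable => // x y xy.
have HE z : H z <-> 0 <= z <= tf by rewrite /horizon /= in_itv.
have [Hx|nHx] := pselect (H x); have [Hy|nHy] := pselect (H y).
- by rewrite !full_exit_timeE//; exact: T_nondecreasing.
- rewrite (full_exit_time_out _ nHy).
  have /HE/andP[_ ] : H (T e x) by apply/full_exit_time_in.
  move/le_trans; apply; rewrite leNgt; apply/negP => yt; apply: nHy.
  by apply/HE; rewrite (ltW yt) andbT; move/HE : Hx => /andP[/le_trans -> ].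
- rewrite (full_exit_time_out _ nHx).
  have /HE/andP[+ _] : H (T e y) by apply/full_exit_time_in.
  apply: le_trans; rewrite leNgt; apply/negP => x0; apply: nHx.
  by apply/HE; rewrite (ltW x0) /= (le_trans xy)//; move/HE : Hy => /andP[].
- by rewrite !full_exit_time_out.
Qed.

Lemma arrive_out w x : ~ H x -> arrive T w x = x.
Proof.
by elim: w x => [//|e w IHw] x nHx /=; rewrite full_exit_time_out// IHw.
Qed.

Lemma arrivalE w j x : H x -> arrival D u w j x = arrive T (take j w) x.
Proof.
rewrite /arrival; elim: (take j w) x => [//|e w' IHw] x Hx /=.
by rewrite IHw ?full_exit_timeE//; exact: exit_in.
Qed.

Lemma preimage_arrival w j (B : set R) :
  H `&` arrival D u w j @^-1` B = H `&` arrive T (take j w) @^-1` B.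
Proof. by apply/seteqP; split => x [Hx] /=; rewrite arrivalE. Qed.

Lemma measurable_preimage_arrival w j (B : set R) : measurable B ->
  measurable (H `&` arrival D u w j @^-1` B).
Proof.
move=> mB; rewrite preimage_arrival.
apply: measurableI; first exact: measurable_horizon.
rewrite -[X in measurable X]setTI.
exact: (measurable_arrive measurable_full_exit_time (take j w) measurableT).
Qed.

(** Test with the indicator of [[0, y]]. Times outside H are fixed by the extended exit times and so
    never enter [[0, y]]; restricting the preimages to H loses nothing. *)
Lemma induced_flow_walk w (h l : R -> R) e : nni h -> nni l ->
  (forall phi, bm phi -> \sum_(j < size w | nth e w j == e)
     J h (fun x => phi (arrive T (take j w) x)) = J l phi) ->
  induced_edge_flow tf D u w h e l.
Proof.
move=> nh nl hl; split; first by case: (inLplus_nni nl).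
move=> y Hy; pose B := `[0, y]%classic : set R.
have mB : measurable B by exact: measurable_itv.
have BH : B `<=` H.
  move=> x; rewrite /B /horizon /= !in_itv /= => /andP[-> /le_trans]; apply.
  by move: Hy; rewrite /horizon /= in_itv /= => /andP[].
have RJ f A : nni f -> measurable A -> \int[sigma]_(x in A) f x = J f \1_A.
  by move=> nf mA; apply: EFin_inj; rewrite wint_indic// /Rintegral fineK//
    -wint_indic.
rewrite -/B (RJ _ _ nl mB) -hl; last exact: bm_indic.
apply: eq_bigr => j _; rewrite RJ//; last exact: measurable_preimage_arrival.
apply: eq_wint => x; rewrite preimage_arrival !indicE; congr ((nat_of_bool _)%:R).
apply/idP/idP; rewrite !inE; last by case.
move=> Bx; split => //; have [//|nHx] := pselect (H x).
by move: Bx; rewrite arrive_out// => /BH.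
Qed.

Lemma exit_fixed c x : (forall e, e \in c -> T e x = x) ->
  forall j, arrive T (take j c) x = x.
Proof.
elim: c => [//|e c IHc] h [//|j] /=.
by rewrite h ?mem_head// IHc// => e' e'c; apply: h; rewrite inE e'c orbT.
Qed.

(** Where [h] is positive, every position of [c] is reached at the departure time, and [e] occupies
    at most one position, so the sum reduces to one term or none. *)
Lemma induced_flow_zero_cycle c (h : R -> R) e : uniq c -> nni h ->
  {ae sigma, forall x, 0 < h x -> forall e, e \in c -> T e x = x} ->
  induced_edge_flow tf D u c h e (fun x => if e \in c then h x else 0).
Proof.
move=> uc nh hT; apply: induced_flow_walk => //.
  by case: (e \in c) => //; exact: nni0.
move=> phi bphi.
have stay (j : 'I_(size c)) : J h (fun x => phi (arrive T (take j c) x)) = J h phi.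
  apply: (@Rintegral_ae_eq setT) => //.
  - apply: measurable_funM; first by case: nh.
    by case: (bm_comp (measurable_arrive measurable_full_exit_time (take j c)) bphi).
  - by apply: measurable_funM; [case: nh|case: bphi].
  apply: ae_impl hT => x hx; rewrite patch_setT.
  have [_ h0 _] := nh; have := h0 x; rewrite le_eqVlt => /predU1P[<-|hp].
    by rewrite !mul0r.
  by rewrite (exit_fixed (hx hp)).
under eq_bigr do rewrite stay.
case: (boolP (e \in c)) => ec; last first.
  rewrite big1 => [|j /eqP je]; last by rewrite -je mem_nth in ec.
  rewrite /J /Rintegral (_ : (fun x => _) = cst 0%E) ?integral0//.
  by apply/funext => x; rewrite mul0r.
have ic : (index e c < size c)%N by rewrite index_mem.
rewrite (big_pred1 (Ordinal ic))// => j /=.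
apply/eqP/eqP => [je|->]; last by rewrite nth_index.
by apply: val_inj; rewrite /= -je index_uniq.
Qed.

Variable g : E -> R -> R.
Hypothesis g_flow : sd_flow src dst s t tf D u g.

Let gc e := pos_part_on (g e).

Lemma g_Lplus e : inLplus tf (g e). Proof. by case: g_flow. Qed.

Lemma wint_outflow e A : measurable A ->
  J (gc e) \1_A = \int[sigma]_(x in A `&` H) g e x.
Proof.
move=> mA; apply: wint_pos_part_on => //.
- exact: g_Lplus.
- by apply: measurableI => //; exact: measurable_horizon.
- exact: bm_indic.
- by move=> x Hx; rewrite !indicE in_setI (mem_set Hx) andbT.
Qed.

Lemma wint_inflow e A : measurable A ->
  J (gc e) (fun x => \1_A (T e x)) =
  \int[sigma]_(x in H `&` exit_time D u e @^-1` (A `&` H)) g e x.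
Proof.
move=> mA.
have BE : H `&` exit_time D u e @^-1` (A `&` H) = H `&` T e @^-1` A.
  apply/seteqP; split => x [Hx] /=; rewrite full_exit_timeE//; first by case.
  by move=> Ax; do !split => //; exact: exit_in.
rewrite BE; apply: wint_pos_part_on => //.
- exact: g_Lplus.
- apply: measurableI; first exact: measurable_horizon.
  rewrite -[X in measurable X]setTI.
  exact: (measurable_full_exit_time e measurableT).
- by apply: (bm_comp (measurable_full_exit_time e)); exact: bm_indic.
- move=> x Hx; rewrite !indicE in_setI (mem_set Hx) /=.
  by congr ((nat_of_bool _)%:R); apply/idP/idP; rewrite !inE.
Qed.

Lemma flow_balance : exists2 r, inLplus tf r &
  (forall v A, measurable A ->
     \sum_(e | src e == v) J (gc e) \1_A <=
     node_inflow sigma dst s T (pos_part_on r) gc v \1_A) /\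
  (forall v A, measurable A -> v != t ->
     \sum_(e | src e == v) J (gc e) \1_A =
     node_inflow sigma dst s T (pos_part_on r) gc v \1_A).
Proof.
have [_ [r rL [_ r_s]] cons g_t] := g_flow; exists r => //.
have nbE v A : measurable A -> node_balance src dst tf D u v g (A `&` H) =
    \sum_(e | src e == v) J (gc e) \1_A -
    \sum_(e | dst e == v) J (gc e) (fun x => \1_A (T e x)).
  move=> mA; rewrite /node_balance; congr (_ - _); apply: eq_bigr => e _.
    by rewrite wint_outflow.
  by rewrite wint_inflow.
have mAH A : measurable A -> measurable (A `&` H).
  by move=> mA; apply: measurableI => //; exact: measurable_horizon.
have AHH A : A `&` H `<=` H by exact: subIsetr.
have bal_s A : measurable A -> \sum_(e | src e == s) J (gc e) \1_A =
    node_inflow sigma dst s T (pos_part_on r) gc s \1_A.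
  move=> mA; have := r_s _ (mAH _ mA) (@AHH A); rewrite nbE//.
  rewrite -(@wint_pos_part_on r _ \1_A)//; last 3 first.
  - exact: mAH.
  - exact: bm_indic.
  - by move=> x Hx; rewrite !indicE in_setI (mem_set Hx) andbT.
  by move/eqP; rewrite subr_eq => /eqP ->; rewrite /node_inflow eqxx.
have bal_v v A : measurable A -> v != s -> v != t ->
    \sum_(e | src e == v) J (gc e) \1_A =
    node_inflow sigma dst s T (pos_part_on r) gc v \1_A.
  move=> mA vs vt; have [_] := cons v vs vt.
  move=> /(_ _ (mAH _ mA) (@AHH A)); rewrite nbE//.
  have -> : \int[sigma]_(x in A `&` H) (cst 0 x : R) = 0.
    by rewrite Rintegral_cst ?mul0r//; exact: mAH.
  by move/eqP; rewrite subr_eq => /eqP ->; rewrite /node_inflow (negbTE vs).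
have bal_eq v A : measurable A -> v != t -> \sum_(e | src e == v) J (gc e) \1_A =
    node_inflow sigma dst s T (pos_part_on r) gc v \1_A.
  move=> mA vt; have [->|vs] := eqVneq v s; first exact: bal_s.
  exact: bal_v.
split => // v A mA; have [->|vs] := eqVneq v s; first by rewrite bal_s.
have [->|vt] := eqVneq v t; last by rewrite bal_eq.
(* If source and sink coincide, the equality at the source settles the case. Otherwise the sink has
   no source term and its sign condition is the inequality wanted. *)
have [<-|st] := eqVneq s t; first by rewrite bal_s.
have := g_t _ (mAH _ mA) (@AHH A); rewrite nbE// subr_le0 => /le_trans; apply.
by rewrite /node_inflow eq_sym (negbTE st) add0r.
Qed.

End Horizon.

(** * The residual is a static circulation *)

Section Residual.
Context {R : realType} {V E : finType} (src dst : E -> V).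
Variables (tf : R) (D : E -> (E -> R -> R) -> R -> R) (u : E -> R -> R).
Local Notation sigma := (@lebesgue_measure R).
Local Notation H := (horizon tf).
Local Notation bm := bounded_measurable.
Local Notation nni := (nonneg_integrable sigma).
Local Notation J := (wint sigma).
Local Notation T := (full_exit_time tf D u).
Hypothesis D_ge0 : forall e x, H x -> 0 <= D e u x.
Hypothesis T_nondecreasing : forall e,
  nondecreasing_on H (exit_time D u e).
Hypothesis A_horizon : forall (w : seq E) (j : nat) x,
  is_walk src dst w -> (j <= size w)%N -> H x -> H (arrival D u w j x).
Variable k : E -> R -> R.
Hypothesis nk : forall e, nni (k e).
Hypothesis k_flow : forall phi : V -> R -> R, (forall v, bm (phi v)) ->
  (forall v x, 0 <= phi v x) ->
  \sum_e J (k e) (phi (src e)) <=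
  \sum_e J (k e) (fun x => phi (dst e) (T e x)).

Let mT e : measurable_fun setT (T e).
Proof. exact: (measurable_full_exit_time T_nondecreasing A_horizon e). Qed.

(* Test k_flow with the remaining time tf - x: delays would make it drop. *)
Lemma residual_no_delay : {ae sigma, forall x, forall e, 0 < k e x -> T e x = x}.
Proof.
pose rem : R -> R := (fun x => tf - x) \_ H.
have HE z : H z <-> 0 <= z <= tf by rewrite /horizon /= in_itv.
have remE x : H x -> rem x = tf - x by move=> Hx; rewrite /rem patchE mem_set.
have rem0 x : ~ H x -> rem x = 0 by move=> nHx; rewrite /rem patchE memNset.
have rem_ge0 x : 0 <= rem x.
  have [Hx|nHx] := pselect (H x); last by rewrite rem0.
  by rewrite remE// subr_ge0; move/HE : Hx => /andP[].
have brem : bm rem.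
  split.
    apply/(measurable_restrict _ (measurable_horizon tf) measurableT).
    by rewrite setTI; apply: measurable_funB.
  exists `|tf| => x; have [Hx|nHx] := pselect (H x).
    rewrite remE//; move/HE : Hx => /andP[x0 xt].
    by rewrite !ger0_norm ?subr_ge0 ?(le_trans x0)// lerBlDr lerDl.
  by rewrite rem0// normr0.
have bremT e : bm (fun x => rem (T e x)) by exact: (bm_comp (mT e)).
pose delay e x := rem x - rem (T e x).
have bdelay e : bm (delay e) by exact: bmB.
have delayE e x : delay e x = T e x - x.
  rewrite /delay; have [Hx|nHx] := pselect (H x).
    by rewrite !remE ?(full_exit_time_in A_horizon)//; ring.
  by rewrite full_exit_time_out// !rem0// !subrr.
have delay_ge0 e x : 0 <= delay e x.
  rewrite delayE; have [Hx|nHx] := pselect (H x).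
    by rewrite full_exit_timeE// /exit_time addrAC subrr add0r D_ge0.
  by rewrite full_exit_time_out// subrr.
have Jdelay : \sum_e J (k e) (delay e) <= 0.
  rewrite (eq_bigr (fun e => J (k e) rem - J (k e) (fun x => rem (T e x)))).
    by rewrite sumrB subr_le0; exact: (k_flow (fun _ => brem) (fun _ => rem_ge0)).
  by move=> e _; exact: (wintB (nk e) brem (bremT e)).
have zero : {ae sigma, forall x, forall e, k e x * delay e x = 0}.
  apply: ae_forall_fin => e; apply: (wint_le0_ae (nk e) (bdelay e) (delay_ge0 e)).
  apply: le_trans Jdelay.
  by rewrite (bigD1 e)//= lerDl sumr_ge0// => e' _; exact: wint_ge0.
apply: ae_impl zero => x h e kp.
have /eqP := h e; rewrite mulf_eq0 gt_eqF//= delayE subr_eq0.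
by move=> /eqP.
Qed.

(** Without delays the flow inequality compares equal times. Tested at a single node it bounds
    outflow by inflow almost everywhere; summed over the nodes both sides are the total of [k], so
    no node can be strict. *)
Lemma residual_circulation : {ae sigma, forall x, forall v,
  \sum_(e | src e == v) k e x = \sum_(e | dst e == v) k e x}.
Proof.
have JT e phi : bm phi -> J (k e) (fun x => phi (T e x)) = J (k e) phi.
  move=> bphi; apply: (@Rintegral_ae_eq _ setT) => //.
  - by apply: measurable_funM; [case: (nk e)|case: (bm_comp (mT e) bphi)].
  - by apply: measurable_funM; [case: (nk e)|case: bphi].
  apply: ae_impl residual_no_delay => x h; rewrite patch_setT.
  have [_ k0 _] := nk e; have := k0 x; rewrite le_eqVlt => /predU1P[<-|kp].
    by rewrite !mul0r.
  by rewrite h.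
have le_v v : {ae sigma, forall x,
    \sum_(e | src e == v) k e x <= \sum_(e | dst e == v) k e x}.
  apply: wint_le_ae => [||A mA]; [exact: nni_sum..|].
  have mA' : measurable (A : set R) by exact: mA.
  have bA : bm (\1_A : R -> R) by exact: bm_indic.
  rewrite !wint_suml//.
  pose phi v' : R -> R := if v' == v then \1_A else fun=> 0.
  have bphi v' : bm (phi v') by rewrite /phi; case: ifP => // _; exact: bm_cst.
  have phi0 v' x : 0 <= phi v' x by rewrite /phi; case: ifP.
  have := k_flow bphi phi0.
  under [X in _ <= X -> _]eq_bigr do rewrite JT//.
  rewrite (bigID (fun e => src e == v)) /=.
  rewrite [X in _ + X <= _]big1 ?addr0; last first.
    by move=> e /negbTE sv; rewrite /phi sv wint0.
  rewrite [X in _ <= X](bigID (fun e => dst e == v)) /=.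
  rewrite [X in _ <= _ + X]big1 ?addr0; last first.
    by move=> e /negbTE dv; rewrite /phi dv wint0.
  rewrite (eq_bigr (fun e => J (k e) \1_A)) => [|e sv]; last by rewrite /phi sv.
  by rewrite [leRHS](eq_bigr (fun e => J (k e) \1_A)) => [|e dv];
    rewrite /phi ?dv.
apply: ae_impl (ae_forall_fin le_v) => x h v.
have := sum_src src (fun e _ => k e x); rewrite -(sum_dst dst (fun e _ => k e x)).
move/eqP; rewrite eq_sym -subr_eq0 -sumrB psumr_eq0 => [|v' _]; last first.
  by rewrite subr_ge0.
move=> /allP /(_ v); rewrite mem_index_enum => /(_ isT) /=.
by rewrite subr_eq0 => /eqP.
Qed.

End Residual.

(** * Assembly of the decomposition and its convergence *)

Section Decomposition.
Context {R : realType} {V E : finType} (src dst : E -> V) (s d : V).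
Variables (tf : R) (D : E -> (E -> R -> R) -> R -> R) (u : E -> R -> R).
Hypothesis D_ge0 : forall e x, horizon tf x -> 0 <= D e u x.
Hypothesis T_nondecreasing : forall e,
  nondecreasing_on (horizon tf) (exit_time D u e).
Hypothesis A_horizon : forall (w : seq E) (j : nat) x,
  is_walk src dst w -> (j <= size w)%N -> horizon tf x ->
  horizon tf (arrival D u w j x).
Variable g : E -> R -> R.
Hypothesis g_flow : sd_flow src dst s d tf D u g.

Local Notation sigma := (@lebesgue_measure R).
Local Notation J := (wint sigma).
Local Notation T := (full_exit_time tf D u).

(** The cycle flows add up to [k], and any finite family of walk flows plus [k] stays below [g]
    almost everywhere. The L^1 error is hence a difference of total masses, which decreases as the
    family grows, so its limit along [W n] controls the whole net. *)
Lemma flow_has_decomposition :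
  exists hw hc : seq E -> R -> R, flow_decomposition src dst s d tf D u g hw hc.
Proof.
pose gc e := pos_part_on tf (g e).
have gL e : inLplus tf (g e) by case: g_flow.
have ngc e : nonneg_integrable sigma (gc e) by apply: nni_pos_part_on; case: (gL e).
have mT e : measurable_fun setT (T e).
  exact: (measurable_full_exit_time T_nondecreasing A_horizon e).
have [r rL [bal_le bal_eq]] := flow_balance T_nondecreasing A_horizon g_flow.
have nr : nonneg_integrable sigma (pos_part_on tf r).
  by apply: nni_pos_part_on; case: rL.
have bal_eq1 v : v != d -> \sum_(e | src e == v) J (gc e) (fun=> 1) =
    node_inflow sigma dst s T (pos_part_on tf r) gc v (fun=> 1).
  move=> vd; have := bal_eq v setT measurableT vd.
  by rewrite (_ : \1_setT = fun=> 1 :> R)//; apply/funext => x; rewrite indicT.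
have [hw [lw [k [nhw hlw hk k_flow]]]] :=
  @walk_decomposition _ _ _ sigma V E src dst s d T (pos_part_on tf r) gc
    mT nr ngc bal_le bal_eq1.
have nk e : nonneg_integrable sigma (k e) by case: (hk e).
have [hc [mhc hc0 hck hcE]] := circulation_decomposition src dst
  (fun e => let: And3 h _ _ := nk e in h) (fun e => let: And3 _ h _ := nk e in h).
pose lc c e x := if e \in c then hc c x else 0.
have no_delay := residual_no_delay D_ge0 T_nondecreasing A_horizon nk k_flow.
have circ := residual_circulation D_ge0 T_nondecreasing A_horizon nk k_flow.
have nhc c : simple_cycle src dst c -> nonneg_integrable sigma (hc c).
  move=> sc; have [e ec] : exists e, e \in c.
    case: c sc => [/andP[/existsP[v]]//|e c _]; by exists e; exact: mem_head.
  split => //; have [mke ke0 ike] := nk e.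
  apply: (le_integrable measurableT _ _ ike); first exact/measurable_EFinP.
  by move=> x _ /=; rewrite lee_fin !ger0_norm//; exact: hck.
have hc_fixed c : simple_cycle src dst c ->
    {ae sigma, forall x, 0 < hc c x -> forall e, e \in c -> T e x = x}.
  move=> sc; apply: ae_impl no_delay => x h hp e ec; apply: h.
  exact: lt_le_trans hp (hck c e x sc ec).
have walkP w : walk src dst s d w ->
    walk_from src dst s w /\ endpoint dst s w = d.
  by rewrite walk_walk_from => /and3P[_ -> /eqP].
exists hw, hc, lw, lc; split.
- move=> w /walkP[pw wd]; split; first exact: inLplus_nni.
  move=> e; have [nl lE] := hlw w pw wd e.
  exact: (induced_flow_walk T_nondecreasing A_horizon).
- move=> c sc; split.
    split; first by apply: inLplus_nni; exact: nhc.
    apply: ae_impl (hc_fixed c sc) => x h Hx hp e ec.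
    have := h hp e ec; rewrite full_exit_timeE// /exit_time => /eqP.
    by rewrite -subr_eq0 addrAC subrr add0r => /eqP.
  move=> e; apply: (induced_flow_zero_cycle T_nondecreasing A_horizon).
  - exact: simple_cycle_uniq sc.
  - exact: nhc.
  - exact: hc_fixed.
move=> e.
pose W n := [seq w <- walks_lt src dst n s | endpoint dst s w == d].
pose nl w := if walk src dst s d w then lw w e else fun=> 0.
have nnl w : nonneg_integrable sigma (nl w).
  rewrite /nl; case: ifP => [/walkP[pw wd]|_]; last exact: nni0.
  by case: (hlw w pw wd e).
have [_ k_le k_lim] := hk e.
have WE n x : \sum_(w <- W n) nl w x <= \sum_(w <- W n) lw w e x.
  rewrite !big_seq; apply: ler_sum => w; rewrite mem_st_walks => /and3P[wd pw _].
  have [[_ lw0 _] _] := hlw w pw (eqP wd) e.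
  by rewrite /nl; case: ifP.
(* The sums can differ only in the empty walk, which belongs to [W n] when [s = d] and [0 < n] but
   is excluded by [walk]; it visits no edge and its flow has mass 0. *)
have JW n : \sum_(w <- W n) J (nl w) (fun=> 1) =
    \sum_(w <- W n) J (lw w e) (fun=> 1).
  rewrite !big_seq; apply: eq_bigr => w; rewrite mem_st_walks => /and3P[wd pw _].
  rewrite /nl walk_walk_from pw wd andbT; case: eqP => //= wnil.
  have b1 : bounded_measurable (fun _ : R => 1 : R) by exact: bm_cst.
  have [_ /(_ _ b1)] := hlw w pw (eqP wd) e; rewrite wnil big_ord0 => <-.
  rewrite /J /wint /Rintegral (_ : (fun x => _) = cst 0%E) ?integral0//.
  by apply/funext => x; rewrite mul0r.
pose sumF (F : {fset seq E}) x := \sum_(w <- F) nl w x.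
have FW (F : {fset seq E}) : exists n, forall x, sumF F x <= \sum_(w <- W n) nl w x.
  pose n := (\max_(w <- F) size w).+1.
  exists n => x; rewrite /sumF.
  rewrite (bigID (fun w => walk src dst s d w)) /=.
  rewrite [X in _ + X]big1 ?addr0; last by move=> w /negbTE nw; rewrite /nl nw.
  rewrite -big_filter; apply: sum_uniq_le.
  - by rewrite filter_uniq// fset_uniq.
  - exact: uniq_st_walks.
  - move=> w; rewrite mem_filter => /andP[/walkP[pw wd] wF].
    by rewrite mem_st_walks pw wd eqxx /= ltnS /n; exact: leq_bigmax_seq.
  - by move=> w; case: (nnl w).
have sumF_le F : {ae sigma, forall x, sumF F x + k e x <= gc e x}.
  have [n hn] := FW F; apply: ae_impl (k_le n) => x; apply: le_trans.
  by rewrite lerD2r (le_trans (hn x)).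
have nsumF F : nonneg_integrable sigma (sumF F).
  split.
  - by apply: measurable_sum => w; case: (nnl w).
  - by move=> x; apply: sumr_ge0 => w _; case: (nnl w).
  - rewrite (_ : EFin \o _ = fun x => (\sum_(w <- F) (nl w x)%:E)%E).
      by apply: integrable_sum => // w _; case: (nnl w).
    by apply/funext => x /=; rewrite sumEFin.
have b1 : bounded_measurable (fun _ : R => 1 : R) by exact: bm_cst.
have errE (F : {fset seq E}) : \int[sigma]_(t in horizon tf)
    `|g e t - (\sum_(w <- F | walk src dst s d w) lw w e t +
               \sum_(c \in [set c | simple_cycle src dst c]) lc c e t)| =
    J (gc e) (fun=> 1) - \sum_(w <- F) J (nl w) (fun=> 1) - J (k e) (fun=> 1).
  have sumE x : \sum_(w <- F | walk src dst s d w) lw w e x = sumF F x.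
    by rewrite big_mkcond; apply: eq_bigr => w _; rewrite /nl; case: ifP.
  pose G x := gc e x - sumF F x - k e x.
  transitivity (\int[sigma]_x G x).
    have mG : measurable_fun setT G.
      apply: measurable_funB; last by case: (nk e).
      by apply: measurable_funB; [case: (ngc e)|case: (nsumF F)].
    apply: Rintegral_ae_eq => //; first exact: measurable_horizon.
      apply: measurableT_comp => //; apply: measurable_funB.
        by apply: measurable_inL; case: (gL e).
      rewrite (_ : (fun x => _) = (fun x => sumF F x +
          \sum_(c <- fset_set [set c | simple_cycle src dst c]) lc c e x)); last first.
        apply/funext => x; rewrite sumE fsbig_finite//.
        exact: finite_simple_cycle.
      apply: measurable_funD; apply: measurable_funTS; first by case: (nsumF F).
      by apply: measurable_sum => c; rewrite /lc;
        case: (e \in c); [exact: mhc|exact: measurable_cst].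
    have circ_clean := ae_impl2 (fun x => @conj _ _) circ (pos_part_on_ae (gL e)).
    apply: ae_impl2 (sumF_le F) circ_clean => x sle [cx clx].
    rewrite patchE /G; case: ifPn => [|nHx].
      rewrite inE => Hx; rewrite -(hcE x (fun v => cx v) e) -clx// sumE opprD addrA.
      by rewrite ger0_norm// -addrA -opprD subr_ge0.
    have nHx' : ~ horizon tf x by move=> Hx; move: nHx; rewrite mem_set.
    have gc0 : gc e x = 0 by exact: pos_part_on_notin.
    (* Off H the almost everywhere bound by [gc e x = 0] forces both nonnegative summands to
       vanish. *)
    move: sle; rewrite gc0 => sle.
    have [_ ke0 _] := nk e; have [_ sF0 _] := nsumF F.
    by have := ke0 x; have := sF0 x; rewrite /point /=; lra.
  have int_nni f : nonneg_integrable sigma f -> sigma.-integrable setT (EFin \o f).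
    by case.
  have intJ f : \int[sigma]_x f x = J f (fun=> 1).
    by apply: eq_Rintegral => x _; rewrite mulr1.
  rewrite /G RintegralB//; last 2 first.
  - exact: (integrableB measurableT (int_nni _ (ngc e)) (int_nni _ (nsumF F))).
  - exact: int_nni.
  rewrite RintegralB//; [|exact: int_nni..].
  rewrite !intJ; congr (_ - _ - _).
  apply: EFin_inj; rewrite wintE// -sumEFin.
  under [RHS]eq_bigr do rewrite wintE//.
  rewrite -integral_sum//; last by move=> w; exact: nni_int.
  by apply: eq_integral => x _; rewrite sumEFin mulr_suml.
have totally_proper := @totally_filter (seq E).
apply/cvgrPdist_lt => eps eps0.
have /cvgrPdist_lt /(_ _ eps0) [N _ hN] := k_lim.
exists (seq_fset tt (W N)) => // F; move/fsubsetP => NF.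
rewrite sub0r normrN ger0_norm; last by apply: Rintegral_ge0.
rewrite errE; have := hN N (leqnn N).
have : \sum_(w <- W N) J (nl w) (fun=> 1) <= \sum_(w <- F) J (nl w) (fun=> 1).
  apply: sum_uniq_le.
  - exact: uniq_st_walks.
  - exact: fset_uniq.
  - by move=> w wW; apply: NF; rewrite seq_fsetE.
  - by move=> w; apply: wint_ge0.
rewrite JW ltr_distlC => le1 /andP[]; lra.
Qed.

End Decomposition.

Theorem theorem4p1 (R : realType) (V E : finType) (src dst : E -> V) (s d : V)
    (tf : R) (D : E -> (E -> R -> R) -> R -> R) (u : E -> R -> R)
    (s_connected : forall v, connect (edge_rel src dst) s v)
    (tf_gt0 : 0 < tf)
    (u_integrable : forall e, inL tf (u e))
    (D_ge0 : forall e t, horizon tf t -> 0 <= D e u t)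
    (D_abs_cont : forall e, absolutely_continuous_on 0 tf (D e u))
    (T_nondecreasing : forall e,
      nondecreasing_on (horizon tf) (exit_time D u e))
    (u_vanishes : exists2 tf' : R, tf' < tf &
      forall e, {ae @lebesgue_measure R, forall t,
        horizon tf t -> tf' <= t -> u e t = 0})
    (A_horizon : forall (w : seq E) (j : nat) (t : R),
      is_walk src dst w -> (j <= size w)%N -> horizon tf t ->
      horizon tf (arrival D u w j t))
    (g : E -> R -> R) :
  sd_flow src dst s d tf D u g ->
  exists hw hc : seq E -> R -> R, flow_decomposition src dst s d tf D u g hw hc.
Proof.
by move=> g_flow; apply: (flow_has_decomposition D_ge0 T_nondecreasing A_horizon).
Qed.
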